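(* Let $p$ be a prime and $F$ a field containing a primitive $p$-th root of unity $\xi_p$. The following are equivalent: (1) there exists $\sigma\in V_F\setminus\Phi(V_F)$ of order $p$; (2) there exists $\sigma\in W_F\setminus\Phi(W_F)$ of order $p$; (3) there exists $\sigma\in V_F\setminus\Phi(V_F)$ such that for every cyclic extension $E/F$ of degree $p$ (inside $F^{(2)}$), the image $\sigma_{E/F}$ of $\sigma$ in $T_{E/F}=\mathrm{Gal}(E^{(2)}/F)$ has order at most $p$; (4) $p=2$ and $F$ is formally real. If these conditions hold, then for an element $\sigma$ as in (1) or (2), the set of elements of $F^\times$ whose square roots are fixed by $\sigma$ is an ordering (positive cone of an ordering) of $F$.
   Context: For a field $K$ containing $\xi_p$: $K^{(2)}$ is the compositum of all cyclic extensions of $K$ of degree $p$; $F^{(3)}$ is the compositum of all cyclic extensions of $F^{(2)}$ of degree $p$ which are Galois over $F$; ${F^{(2)}}^{(2)}$ is the compositum of all cyclic extensions of $F^{(2)}$ of degree $p$. $W_F=\mathrm{Gal}(F^{(3)}/F)$ and $V_F=\mathrm{Gal}({F^{(2)}}^{(2)}/F)$; $\Phi$ denotes the Frattini subgroup. For a cyclic extension $E/F$ of degree $p$, $T_{E/F}=G_F/G_E^p[G_E,G_E]=\mathrm{Gal}(E^{(2)}/F)$, a quotient of $V_F$. *)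

(* Defs.v *)
From mathcomp Require Import all_boot all_order all_algebra.
From mathcomp Require Import boolp classical_sets functions.
Set Implicit Arguments.
Unset Strict Implicit.
Unset Printing Implicit Defensive.
Import GRing.Theory.
Local Open Scope ring_scope.
Local Open Scope classical_set_scope.

(* All fields are subfields of an ambient field Om, given as sets of elements
   of Om. *)

Definition is_subfield (Om : fieldType) (K : set Om) : Prop :=
  divring_closed [pred x | x \in K].

Definition adjoin (Om : fieldType) (K A : set Om) : set Om :=
  smallest (@is_subfield Om) (K `|` A).

Definition compositum (Om : fieldType) (K : set Om) (C : set (set Om)) : set Om :=
  adjoin K (\bigcup_(L in C) L).

(* Gal K L is the group of K-automorphisms of L. An automorphism of L is
   extended by the identity outside L, so that it is determined by its values
   on L, and the group law, neutral element and powers are \o, id and iter. *)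
Definition Gal (Om : fieldType) (K L : set Om) : set (Om -> Om) :=
  [set s | [/\ set_bij L L s,
               {in L &, {morph s : x y / x + y}},
               {in L &, {morph s : x y / x * y}},
               {in K, s =1 id} &
               {in ~` L, s =1 id}]].

(* The image of s in Gal K L, for s in Gal K M with K <= L <= M and L normal
   over K. *)
Definition restriction (Om : fieldType) (L : set Om) (s : Om -> Om) : Om -> Om :=
  patch id L s.

Definition has_order (Om : Type) (s : Om -> Om) (n : nat) : Prop :=
  [/\ (0 < n)%N, iter n s =1 id &
      forall m : nat, (0 < m < n)%N -> ~ (iter m s =1 id)].

Definition algebraic_ext (Om : fieldType) (K L : set Om) : Prop :=
  forall x, L x ->
    exists q : {poly Om}, [/\ q != 0, (forall i, K q`_i) & root q x].

(* L / K is Galois: algebraic, and K is the fixed field of Gal K L. *)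
Definition galois_ext (Om : fieldType) (K L : set Om) : Prop :=
  [/\ is_subfield K, is_subfield L, K `<=` L, algebraic_ext K L &
      forall x, L x -> (forall s, Gal K L s -> s x = x) -> K x].

(* L / K is Galois with cyclic Galois group of order n. *)
Definition cyclic_ext (Om : fieldType) (n : nat) (K L : set Om) : Prop :=
  galois_ext K L /\
  exists2 s, has_order s n & Gal K L = [set iter m s | m in [set: nat]].

Definition ext2 (Om : fieldType) (p : nat) (K : set Om) : set Om :=
  compositum K [set L | cyclic_ext p K L].

Definition ext3 (Om : fieldType) (p : nat) (K : set Om) : set Om :=
  compositum (ext2 p K)
    [set L | cyclic_ext p (ext2 p K) L /\ galois_ext K L].

Definition is_subgroup (T : Type) (G H : set (T -> T)) : Prop :=
  [/\ H `<=` G, H id, (forall s t, H s -> H t -> H (s \o t)) &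
      forall s, H s -> exists2 t, H t & s \o t = id /\ t \o s = id].

(* Open for the Krull topology on Gal K L, L / K algebraic: H contains
   Gal(L / M) for some finite subextension M = K(A) of L / K. *)
Definition open_subgroup (Om : fieldType) (K L : set Om) (H : set (Om -> Om)) :
    Prop :=
  is_subgroup (Gal K L) H /\
  exists2 A : seq Om, [set` A] `<=` L & Gal (adjoin K [set` A]) L `<=` H.

Definition maximal_open_subgroup (Om : fieldType) (K L : set Om)
    (H : set (Om -> Om)) : Prop :=
  [/\ open_subgroup K L H, H <> Gal K L &
      forall H', open_subgroup K L H' -> H `<=` H' ->
        H' = H \/ H' = Gal K L].

(* The Frattini subgroup of the profinite group Gal K L: the intersection of
   its maximal open subgroups (the whole group if there are none). *)
Definition Frattini_Gal (Om : fieldType) (K L : set Om) : set (Om -> Om) :=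
  Gal K L `&` \bigcap_(H in [set H | maximal_open_subgroup K L H]) H.

Definition V_ (Om : fieldType) (p : nat) (K : set Om) : set (Om -> Om) :=
  Gal K (ext2 p (ext2 p K)).

Definition Phi_V (Om : fieldType) (p : nat) (K : set Om) : set (Om -> Om) :=
  Frattini_Gal K (ext2 p (ext2 p K)).

Definition W_ (Om : fieldType) (p : nat) (K : set Om) : set (Om -> Om) :=
  Gal K (ext3 p K).

Definition Phi_W (Om : fieldType) (p : nat) (K : set Om) : set (Om -> Om) :=
  Frattini_Gal K (ext3 p K).

Definition formally_real (F : fieldType) : Prop :=
  forall s : seq F, \sum_(x <- s) x ^+ 2 != -1.

Definition positive_cone (F : fieldType) (P : set F) : Prop :=
  [/\ (forall x y, P x -> P y -> P (x + y)),
      (forall x y, P x -> P y -> P (x * y)),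
      ~ P 0 &
      forall x, x != 0 -> P x \/ P (- x)].

Definition fixed_sqrt_set (F Om : fieldType) (iota : F -> Om) (s : Om -> Om) :
    set F :=
  [set a | a != 0 /\ forall y : Om, y ^+ 2 = iota a -> s y = y].

(* Main.v *)
(** The [p]-th roots generate [ext2], so everything takes place in the tower
    [F <= F2 <= F22] of Kummer extensions, and every element of the Galois
    groups extends to an automorphism of the algebraic closure. A maximal open
    subgroup has index [p] in a pro-[p] group, so an element [s] outside the
    Frattini subgroup moves some [p]-th root [a] of an element of [F]. If
    [s ^ p] fixes a [p]-th root of [a], comparing with a primitive root of
    unity of order [p ^ 2] forces [p = 2] and [s i = - i]. If moreover [s ^ 2]
    fixes [b] with [b ^ 2 = 1 + a], where [a ^ 2 = - c], then [b * s b] is an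
    [s]-fixed square root of [1 + c]; so the elements of [F] whose square roots
    are fixed by [s] form a positive cone. Conversely, for [F] formally real,
    a maximal formally real subfield [R] of the closure makes [R(i)] closed
    under square roots, and conjugation on [R(i)] restricts to the desired
    involution. *)

Require Import Defs.
From HB Require Import structures.
From mathcomp Require Import all_boot all_order all_algebra.
From mathcomp Require Import all_fingroup all_solvable.
From mathcomp Require Import boolp classical_sets functions.
From mathcomp Require Import ring.
Set Implicit Arguments.
Unset Strict Implicit.
Unset Printing Implicit Defensive.
Import GRing.Theory.
Local Open Scope ring_scope.
Local Open Scope classical_set_scope.

(** * Subfields and the extension of embeddings *)

(** The conditions on [s] are all used through one weak consequence, [kummer_torsion]: the [p]-th
    iterate fixes the [p]-th roots of [a] and, for [p = 2], the square roots of [1 + a], for those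
    [a] moved by [s] with [a ^+ p] in [F]. These roots are Kummer elements over [F(a)], which serves
    (3). A conjugate of such a root is the root, or its inverse, times an element of [F2], so
    adjoining it to [F2] gives a field Galois over [F], which serves (2). Elements of [Gal K L] are
    bare functions; each is first replaced by a ring endomorphism of the closure, whose surjectivity
    on [L] comes from finite sets of conjugates. The Frattini subgroup is likewise handled on a
    finite stable set [Y], where the Galois group becomes a finite permutation group. There a
    maximal subgroup is turned into a [p]-th root by a Lagrange resolvent. *)

Section SubfieldType.
Variables (Om : fieldType) (K : set Om) (hK : is_subfield K).

(** The proof is an argument of the predicate so that a closure instance can be attached to it;
    every set that is a subfield then yields a [fieldType]. *)
Definition subfield_pred (_ : is_subfield K) : {pred Om} := [pred x | x \in K].
HB.instance Definition _ :=
  GRing.isDivringClosed.Build Om (subfield_pred hK) hK.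

Record subfield_type :=
  SubfieldType { subfield_val : Om; _ : subfield_val \in subfield_pred hK }.
HB.instance Definition _ := [isSub for subfield_val].
HB.instance Definition _ := [Choice of subfield_type by <:].
HB.instance Definition _ := [SubChoice_isSubIntegralDomain of subfield_type by <:].
HB.instance Definition _ := [SubIntegralDomain_isSubField of subfield_type by <:].

Lemma subfield_valP (x : subfield_type) : K (val x).
Proof. by have := valP x; rewrite !inE. Qed.

Lemma subfield_lift x : K x -> exists a : subfield_type, val a = x.
Proof.
move=> Kx; have xK : x \in subfield_pred hK by rewrite !inE.
by exists (SubfieldType xK).
Qed.

Lemma subfield_poly_lift (q : {poly Om}) : (forall i, K q`_i) ->
  exists q' : {poly subfield_type}, map_poly val q' = q.
Proof.
move=> Kq; have [c cq] := choice (fun i => subfield_lift (Kq i)).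
exists (\poly_(i < size q) c i); apply/polyP => i.
rewrite coef_map coef_poly; case: ifP => [_|] //=.
by move/negbT; rewrite -leqNgt => /(nth_default 0) ->.
Qed.

End SubfieldType.

Section Zorn.
Variable T : Type.

Lemma Zorn_above (P : set (set T)) (A0 : set T) : P A0 ->
  (forall C : set (set T), C !=set0 -> C `<=` P -> total_on C subset ->
     P (\bigcup_(A in C) A)) ->
  exists A, [/\ P A, A0 `<=` A & forall B, P B -> A `<=` B -> B = A].
Proof.
move=> PA0 Pchain.
(* [Zorn_bigcup] also ranges over the empty chain, whose union is empty; adding [A0] to every set
   makes that case [P A0]. *)
pose P' := [set A | P (A `|` A0)].
have [|A [PA Amax]] := @Zorn_bigcup T P'.
  move=> C CP Ctot; rewrite /P' /=.
  have [C0|/set0P C0] := eqVneq C set0; first by rewrite C0 bigcup_set0 set0U.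
  have -> : \bigcup_(X in C) X `|` A0 = \bigcup_(X in [set A `|` A0 | A in C]) X.
    rewrite bigcup_image; apply/seteqP; split => x.
      case=> [[A CA Ax]|A0x]; first by exists A => //; left.
      by case: C0 => A CA; exists A => //; right.
    by case=> A CA [Ax|A0x]; [left; exists A|right].
  apply: Pchain.
  - by case: C0 => A CA; exists (A `|` A0); exists A.
  - by move=> _ [A CA <-]; exact: CP.
  - move=> _ _ [A CA <-] [B CB <-].
    by case: (Ctot _ _ CA CB) => AB; [left|right]; exact: setSU.
exists (A `|` A0); split => //.
move=> B PB AB; apply: contrapT => nAB; apply: (Amax B); last first.
  by rewrite /P' /= setUidl// => x A0x; apply: AB; right.
split; first by move=> x Ax; apply: AB; left.
by move=> BA; apply: nAB; apply/seteqP; split => // x Bx; left; exact: BA.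
Qed.

End Zorn.

(** Stated over any ring, so that it also covers sets of polynomials and graphs in [Om * Om], which
    is not a field. *)
Definition subring_set (R : nzRingType) (K : set R) : Prop :=
  [/\ K 1, forall x y, K x -> K y -> K (x - y) &
      forall x y, K x -> K y -> K (x * y)].

Section SubringSet.
Variables (R : nzRingType) (K : set R) (hK : subring_set K).

Lemma subring_set0 : K 0.
Proof. by have [K1 KB _] := hK; rewrite -(subrr 1); exact: KB. Qed.

Lemma subring_setN x : K x -> K (- x).
Proof.
have [_ KB _] := hK => Kx; rewrite -sub0r; apply: KB => //.
exact: subring_set0.
Qed.

Lemma subring_setB x y : K x -> K y -> K (x - y).
Proof. by have [_ KB _] := hK; exact: KB. Qed.

Lemma subring_setD x y : K x -> K y -> K (x + y).
Proof. by move=> Kx /subring_setN Ky; rewrite -(opprK y); exact: subring_setB. Qed.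

Lemma subring_setM x y : K x -> K y -> K (x * y).
Proof. by have [_ _] := hK; apply. Qed.

Lemma subring_setX x n : K x -> K (x ^+ n).
Proof.
move=> Kx; elim: n => [|n IH]; first by rewrite expr0; case: hK.
by rewrite exprS; exact: subring_setM.
Qed.

Lemma subring_set_sum (I : Type) (r : seq I) (P : pred I) (f : I -> R) :
  (forall i, P i -> K (f i)) -> K (\sum_(i <- r | P i) f i).
Proof.
move=> Kf; apply: (big_ind K) => //; first exact: subring_set0.
exact: subring_setD.
Qed.

Lemma subring_set_horner (q : {poly R}) x :
  (forall i, K q`_i) -> K x -> K q.[x].
Proof.
move=> Kq Kx; rewrite horner_coef; apply: subring_set_sum => i _.
by apply: subring_setM => //; exact: subring_setX.
Qed.

Lemma subring_set_prod (I : Type) (r : seq I) (P : pred I) (f : I -> R) :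
  (forall i, P i -> K (f i)) -> K (\prod_(i <- r | P i) f i).
Proof. by move=> Kf; apply: (big_ind K) => //; [case: hK|exact: subring_setM]. Qed.

Lemma subring_set_coef : subring_set [set q : {poly R} | forall i, K q`_i].
Proof.
split=> /= [i|q r Kq Kr i|q r Kq Kr i].
- by rewrite coef1; case: eqP => _; [case: hK|exact: subring_set0].
- by rewrite coefB; exact: subring_setB.
- rewrite coefM; apply: subring_set_sum => j _; exact: subring_setM.
Qed.

Lemma subring_set_XsubC x : K x -> forall i, K ('X - x%:P)`_i.
Proof.
move=> Kx i; rewrite coefB coefX coefC; apply: subring_setB.
  by case: eqP => _; [case: hK|exact: subring_set0].
by case: eqP => _ //; exact: subring_set0.
Qed.

End SubringSet.

Lemma chain_subring_set (R : nzRingType) (C : set (set R)) : C !=set0 ->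
  (forall A, C A -> subring_set A) -> total_on C subset ->
  subring_set (\bigcup_(A in C) A).
Proof.
move=> [A0 CA0] hC Ctot.
have both x y : (\bigcup_(A in C) A) x -> (\bigcup_(A in C) A) y ->
    exists A, [/\ C A, A x & A y].
  move=> [A CA Ax] [B CB By]; have [AB|BA] := Ctot _ _ CA CB.
    by exists B; split => //; exact: AB.
  by exists A; split => //; exact: BA.
split; first by exists A0 => //; have [] := hC _ CA0.
  move=> x y hx hy; have [A [CA Ax Ay]] := both _ _ hx hy.
  by exists A => //; exact: (subring_setB (hC _ CA)).
move=> x y hx hy; have [A [CA Ax Ay]] := both _ _ hx hy.
by exists A => //; exact: (subring_setM (hC _ CA)).
Qed.

Section Subfield.
Variables (Om : fieldType).
Implicit Types (K A : set Om).

Lemma is_subfieldP K :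
  is_subfield K <-> subring_set K /\ (forall x, K x -> K x^-1).
Proof.
split=> [[K1 KB KD]|[hK KV]].
  have {}K1 : K 1 by move: K1; rewrite !inE.
  have {}KB x y : K x -> K y -> K (x - y).
    by move=> Kx Ky; have := KB x y; rewrite !inE; exact.
  have {}KD x y : K x -> K y -> K (x / y).
    by move=> Kx Ky; have := KD x y; rewrite !inE; exact.
  have KV x : K x -> K x^-1 by move=> Kx; rewrite -div1r; exact: KD.
  split=> //; split=> // x y Kx Ky.
  by rewrite -(invrK y); apply: KD => //; exact: KV.
split; first by rewrite !inE; case: hK.
  by move=> x y; rewrite !inE; exact: subring_setB.
by move=> x y; rewrite !inE => Kx Ky; apply: subring_setM => //; exact: KV.
Qed.

Lemma subfield_ring K : is_subfield K -> subring_set K.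
Proof. by case/is_subfieldP. Qed.

Lemma subfieldV K x : is_subfield K -> K x -> K x^-1.
Proof. by case/is_subfieldP => _; exact. Qed.

Lemma subfield_div K x y : is_subfield K -> K x -> K y -> K (x / y).
Proof.
move=> hK Kx Ky; apply: (subring_setM (subfield_ring hK)) => //.
exact: subfieldV.
Qed.

Lemma adjoin_subfield K A : is_subfield (adjoin K A).
Proof.
apply/is_subfieldP; split; first split.
- by move=> M [hM _]; have [] := subfield_ring hM.
- move=> x y hx hy M hM; have [/subfield_ring h _] := hM.
  by apply: (subring_setB h); [exact: hx|exact: hy].
- move=> x y hx hy M hM; have [/subfield_ring h _] := hM.
  by apply: (subring_setM h); [exact: hx|exact: hy].
by move=> x hx M hM; have [h _] := hM; apply: subfieldV => //; exact: hx.
Qed.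

Lemma adjoin_base K A : K `<=` adjoin K A.
Proof. by move=> x Kx M [_]; apply; left. Qed.

Lemma adjoin_gen K A : A `<=` adjoin K A.
Proof. by move=> x Kx M [_]; apply; right. Qed.

Lemma adjoin_min K A M : is_subfield M -> K `<=` M -> A `<=` M -> adjoin K A `<=` M.
Proof. by move=> hM KM AM x; apply; split => // y [/KM|/AM]. Qed.

Lemma adjoin_sub K A K' A' : K `<=` adjoin K' A' -> A `<=` adjoin K' A' ->
  adjoin K A `<=` adjoin K' A'.
Proof. by apply: adjoin_min; exact: adjoin_subfield. Qed.

Lemma preimage_subfield (s : {rmorphism Om -> Om}) K : is_subfield K ->
  is_subfield (s @^-1` K).
Proof.
move=> hK; have hR := subfield_ring hK; apply/is_subfieldP; split; first split.
- by rewrite /preimage /= rmorph1; case: hR.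
- by move=> x y; rewrite /preimage /= rmorphB; exact: subring_setB.
- by move=> x y; rewrite /preimage /= rmorphM; exact: subring_setM.
- by move=> x; rewrite /preimage /= fmorphV; exact: subfieldV.
Qed.

Lemma range_subfield (Kt : fieldType) (v : {rmorphism Kt -> Om}) :
  is_subfield (range v).
Proof.
apply/is_subfieldP; split; first split.
- by exists 1 => //; rewrite rmorph1.
- by move=> _ _ [a _ <-] [b _ <-]; exists (a - b) => //; rewrite rmorphB.
- by move=> _ _ [a _ <-] [b _ <-]; exists (a * b) => //; rewrite rmorphM.
- by move=> _ [a _ <-]; exists a^-1 => //; rewrite fmorphV.
Qed.

Lemma eqset_subfield (s t : {rmorphism Om -> Om}) :
  is_subfield [set x | s x = t x].
Proof.
apply/is_subfieldP; split; first split; rewrite /=.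
- by rewrite !rmorph1.
- by move=> x y; rewrite !rmorphB => -> ->.
- by move=> x y; rewrite !rmorphM => -> ->.
- by move=> x; rewrite !fmorphV => ->.
Qed.

Lemma adjoinU K A B : adjoin K (A `|` B) = adjoin (adjoin K A) B.
Proof.
apply/seteqP; split; apply: adjoin_sub.
- by move=> x Kx; apply: adjoin_base; exact: adjoin_base.
- by move=> x [Ax|Bx]; [apply: adjoin_base; exact: adjoin_gen|exact: adjoin_gen].
- by apply: adjoin_sub; [exact: adjoin_base|move=> x Ax; apply: adjoin_gen; left].
- by move=> x Bx; apply: adjoin_gen; right.
Qed.

Lemma adjoin_finite K A x : is_subfield K -> adjoin K A x ->
  exists2 r : seq Om, [set` r] `<=` A & adjoin K [set` r] x.
Proof.
move=> hK.
pose M := [set x | exists2 r : seq Om, [set` r] `<=` A & adjoin K [set` r] x].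
have hM : is_subfield M.
  have cat2 x1 x2 : M x1 -> M x2 -> exists r : seq Om,
      [/\ [set` r] `<=` A, adjoin K [set` r] x1 & adjoin K [set` r] x2].
    move=> [r1 r1A hx1] [r2 r2A hx2]; exists (r1 ++ r2); split.
    - by move=> y; rewrite /= mem_cat => /orP[/r1A|/r2A].
    - apply: adjoin_sub hx1; first exact: adjoin_base.
      by move=> y /= yr; apply: adjoin_gen; rewrite /= mem_cat yr.
    - apply: adjoin_sub hx2; first exact: adjoin_base.
      by move=> y /= yr; apply: adjoin_gen; rewrite /= mem_cat yr orbT.
  apply/is_subfieldP; split; first split.
  - exists [::] => //; apply: adjoin_base; by have [] := subfield_ring hK.
  - move=> y z hy hz; have [r [rA ry rz]] := cat2 _ _ hy hz; exists r => //.
    exact: (subring_setB (subfield_ring (adjoin_subfield _ _))).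
  - move=> y z hy hz; have [r [rA ry rz]] := cat2 _ _ hy hz; exists r => //.
    exact: (subring_setM (subfield_ring (adjoin_subfield _ _))).
  - move=> y [r rA ry]; exists r => //.
    exact: (subfieldV (adjoin_subfield _ _)).
apply: (adjoin_min hM).
  by move=> y Ky; exists [::] => //; exact: adjoin_base.
move=> y Ay; exists [:: y]; last by apply: adjoin_gen; rewrite /= inE.
by move=> z /=; rewrite inE => /eqP ->.
Qed.

End Subfield.

(** * Conjugates and the extension of embeddings to the closure *)

Section Mate.
Variables (Kt : fieldType) (Om : closedFieldType) (i f : {rmorphism Kt -> Om}).

(** A polynomial [m] of least size vanishing at [x] divides every [q] that vanishes there, so any
    root [y] of its image under [f] will do. *)
Lemma conjugate_exists x : algebraicOver i x ->
  exists y, forall q : {poly Kt}, root (map_poly i q) x -> root (map_poly f q) y.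
Proof.
case=> q0 q0_neq0 q0x.
pose P n := `[< exists q : {poly Kt}, [/\ q != 0, root (map_poly i q) x & size q = n] >].
have exP : exists n, P n by exists (size q0); apply/asboolP; exists q0.
case: (ex_minnP exP) => n /asboolP[m [m_neq0 mx szm]] nmin.
have m_dvd q : root (map_poly i q) x -> m %| q.
  move=> qx; rewrite /dvdp; apply: contraT => r_neq0.
  have /nmin : P (size (q %% m)).
    apply/asboolP; exists (q %% m); split => //.
    move: qx; rewrite {1}(divp_eq q m) rmorphD rmorphM /= !rootE !hornerE.
    by rewrite (rootP mx) mulr0 add0r.
  by rewrite leqNgt -szm ltn_modp m_neq0.
have : size (map_poly f m) != 1%N.
  rewrite size_map_poly; apply: contraTneq mx => /eqP/size_poly1P[c c0 ->].
  by rewrite map_polyC /= rootC fmorph_eq0.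
case/closed_rootP => y my; exists y => q /m_dvd/dvdpP[r ->].
by rewrite rmorphM /= rootM my orbT.
Qed.

Variables x y : Om.
Hypothesis xy : forall q : {poly Kt}, root (map_poly i q) x -> root (map_poly f q) y.

(** The graph of the extension of [f] to [i(Kt)[x]] with [x] sent to [y]. As a set of pairs it makes
    sense before it is known to be a function; for a subring, uniqueness of the value at [0] is
    enough for that. *)
Definition eval_graph : set (Om * Om) :=
  range (fun q : {poly Kt} => ((map_poly i q).[x], (map_poly f q).[y])).

Lemma eval_graph_subring : subring_set eval_graph.
Proof.
split.
- by exists 1 => //; rewrite !rmorph1 !hornerE.
- by move=> _ _ [q _ <-] [r _ <-]; exists (q - r) => //; rewrite !rmorphB /= !hornerE.
- by move=> _ _ [q _ <-] [r _ <-]; exists (q * r) => //; rewrite !rmorphM /= !hornerM.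
Qed.

Lemma eval_graph_functional z : eval_graph (0, z) -> z = 0.
Proof. by case=> q _ [/eqP qx <-]; apply/eqP; apply: xy. Qed.

End Mate.

Section AlgebraicClosure.
Variables (F : fieldType) (Om : closedFieldType) (iota : {rmorphism F -> Om}).
Hypothesis Om_alg : forall x : Om, algebraicOver iota x.
Notation F0 := (range iota : set Om).
Implicit Types (K L M : set Om).

Lemma F0_poly (q : {poly F}) i : F0 (map_poly iota q)`_i.
Proof. by rewrite coef_map; exists q`_i. Qed.

(** Strip factors ['X] from a polynomial over [F] that kills [u] until its constant term [c] is
    nonzero: then [q.[u] * u + c = 0] expresses the inverse of [u] as a polynomial in [u]. *)
Lemma subring_subfield K : subring_set K -> F0 `<=` K -> is_subfield K.
Proof.
move=> hK F0K; apply/is_subfieldP; split=> // u Ku.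
have [->|u0] := eqVneq u 0; first by rewrite invr0; exact: subring_set0.
have [q] := Om_alg u; elim/poly_ind: q => [|q c IH]; first by rewrite eqxx.
rewrite rmorphD rmorphM /= map_polyX map_polyC /= rootE !hornerE.
have [->|c0] := eqVneq c 0.
  rewrite polyC0 rmorph0 !addr0 => qX; rewrite mulf_eq0 (negPf u0) orbF.
  by apply: IH; apply: contra_neq qX => ->; rewrite mul0r.
move=> _; rewrite addr_eq0 => /eqP qu.
have -> : u^-1 = (map_poly iota q).[u] * - (iota c^-1).
  apply: (mulIf u0); rewrite mulVf // mulrAC qu mulrNN -rmorphM mulfV //.
  by rewrite rmorph1.
apply: (subring_setM hK).
  by apply: (subring_set_horner hK) => // i; apply: F0K; exact: F0_poly.
by apply: (subring_setN hK); apply: F0K; exists c^-1.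
Qed.

Lemma algebraicOver_subfield K (hK : is_subfield K) x : F0 `<=` K ->
  algebraicOver (val : subfield_type hK -> Om) x.
Proof.
move=> F0K; have [q q0 qx] := Om_alg x.
have [r rE] := subfield_poly_lift hK (fun i => F0K _ (F0_poly q i)).
exists r; last by rewrite rE.
by rewrite -(map_poly_eq0 (val : {rmorphism subfield_type hK -> Om})) rE map_poly_eq0.
Qed.

(* Zorn's lemma on subrings of [Om * Om] that are graphs. *)
Lemma extend_graph (G0 : set (Om * Om)) : subring_set G0 ->
  (forall y, G0 (0, y) -> y = 0) -> (forall a, F0 a -> G0 (a, a)) ->
  exists s : {rmorphism Om -> Om}, forall x y, G0 (x, y) -> s x = y.
Proof.
move=> G0ring G0fun G0F.
pose P := [set G : set (Om * Om) | subring_set G /\ forall y, G (0, y) -> y = 0].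
have [||G [[Gring Gfun] G0G Gmax]] := @Zorn_above _ P G0; first by split.
  move=> C C0 CP Ctot; split; last by move=> y [A /CP[_ hA] /hA].
  by apply: chain_subring_set => // A /CP[].
have Guniq x y z : G (x, y) -> G (x, z) -> y = z.
  move=> Gy Gz; apply/eqP; rewrite -subr_eq0; apply/eqP/Gfun.
  by rewrite -(subrr x); exact: (subring_setB Gring Gy Gz).
pose D := [set x | exists y, G (x, y)].
have F0D : F0 `<=` D by move=> a /G0F/G0G Ga; exists a.
have hD : is_subfield D.
  apply: subring_subfield => //; split; first by exists 1; case: Gring.
    move=> x y [x' hx] [y' hy]; exists (x' - y').
    exact: (subring_setB Gring hx hy).
  move=> x y [x' hx] [y' hy]; exists (x' * y').
  exact: (subring_setM Gring hx hy).
have [f fG] := choice (fun d : subfield_type hD => subfield_valP d).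
have fB : zmod_morphism f.
  move=> a b; apply: (Guniq (val (a - b))) => //.
  by rewrite rmorphB; exact: (subring_setB Gring (fG a) (fG b)).
have fM : monoid_morphism f.
  split; first by apply: (Guniq (val (1 : subfield_type hD))) => //; case: Gring.
  move=> a b; apply: (Guniq (val (a * b))) => //.
  by rewrite rmorphM; exact: (subring_setM Gring (fG a) (fG b)).
pose fr : {rmorphism subfield_type hD -> Om} := HB.pack f
  (GRing.isZmodMorphism.Build _ _ f fB) (GRing.isMonoidMorphism.Build _ _ f fM).
(* Sending [x] to a conjugate extends the graph [G]; by maximality nothing was added, so [x] was
   already in the domain. *)
have DT x : D x.
  have [y xy] := conjugate_exists fr (algebraicOver_subfield hD x F0D).
  rewrite /D /=; have <- : eval_graph (val : {rmorphism _ -> _}) fr x y = G.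
    apply: Gmax; first by split; [exact: eval_graph_subring|exact: eval_graph_functional].
    move=> [u v] Guv; have [d du] : exists d : subfield_type hD, val d = u.
      by apply: subfield_lift; exists v.
    exists d%:P => //; rewrite !map_polyC !hornerC /= du; congr (_, _).
    by apply: (Guniq u) => //; rewrite -du.
  by exists y, 'X => //; rewrite !map_polyX !hornerX.
have [s sG] := choice DT.
have sB : zmod_morphism s.
  by move=> a b; apply: (Guniq (a - b)) => //; exact: (subring_setB Gring (sG a) (sG b)).
have sM : monoid_morphism s.
  split; first by apply: (Guniq 1) => //; case: Gring.
  by move=> a b; apply: (Guniq (a * b)) => //; exact: (subring_setM Gring (sG a) (sG b)).
pose sr : {rmorphism Om -> Om} := HB.pack s
  (GRing.isZmodMorphism.Build _ _ s sB) (GRing.isMonoidMorphism.Build _ _ s sM).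
by exists sr => x y /G0G; exact: Guniq.
Qed.

Lemma extend_embedding L (s : Om -> Om) : is_subfield L -> F0 `<=` L ->
  {in L &, {morph s : x y / x + y}} -> {in L &, {morph s : x y / x * y}} ->
  (forall a, F0 a -> s a = a) ->
  exists t : {rmorphism Om -> Om}, forall x, L x -> t x = s x.
Proof.
move=> hL F0L sD sM sF; have hR := subfield_ring hL.
have {}sD x y : L x -> L y -> s (x + y) = s x + s y.
  by move=> Lx Ly; apply: sD; rewrite in_setE.
have {}sM x y : L x -> L y -> s (x * y) = s x * s y.
  by move=> Lx Ly; apply: sM; rewrite in_setE.
have s0 : s 0 = 0 by apply: sF; exists 0 => //; rewrite rmorph0.
have sN x : L x -> s (- x) = - s x.
  move=> Lx; apply/eqP; rewrite -addr_eq0 -sD ?addNr ?s0 //.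
  exact: subring_setN.
have [|||t tE] := @extend_graph [set u | L u.1 /\ u.2 = s u.1].
- split => /=.
  + by split; [case: hR|rewrite sF//; exists 1 => //; rewrite rmorph1].
  + move=> [x1 x2] [y1 y2] /= [Lx ->] [Ly ->]; split; first exact: subring_setB.
    by rewrite sD ?sN //; exact: subring_setN.
  + move=> [x1 x2] [y1 y2] /= [Lx ->] [Ly ->]; split; first exact: subring_setM.
    by rewrite sM.
- by move=> y /= [_ ->].
- by move=> a Fa /=; split; [exact: F0L|rewrite sF].
by exists t => x Lx; apply: tE.
Qed.

Lemma extend_conjugate K x y : is_subfield K -> F0 `<=` K ->
  (forall q : {poly Om}, (forall i, K q`_i) -> root q x -> root q y) ->
  exists s : {rmorphism Om -> Om}, (forall a, K a -> s a = a) /\ s x = y.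
Proof.
move=> hK F0K xy.
pose v : {rmorphism subfield_type hK -> Om} := val.
have Kv (q : {poly subfield_type hK}) i : K (map_poly v q)`_i.
  by rewrite coef_map; exact: subfield_valP.
have vG a : K a -> eval_graph v v x y (a, a).
  move=> /(@subfield_lift _ _ hK)[b <-].
  by exists b%:P => //; rewrite !map_polyC !hornerC.
have [|||s sE] := @extend_graph (eval_graph v v x y).
- exact: eval_graph_subring.
- by apply: eval_graph_functional => q; apply: xy.
- by move=> a /F0K; exact: vG.
exists s; split; first by move=> a /vG/sE.
by apply: sE; exists 'X => //; rewrite map_polyX !hornerX.
Qed.

Lemma adjoin1_poly K a x : is_subfield K -> F0 `<=` K -> adjoin K [set a] x ->
  exists2 q : {poly Om}, (forall i, K q`_i) & x = q.[a].
Proof.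
move=> hK F0K; have hR := subfield_ring hK.
pose M : set Om := [set x | exists2 q : {poly Om}, (forall i, K q`_i) & x = q.[a]].
have KM : K `<=` M.
  move=> b Kb; exists b%:P; last by rewrite hornerC.
  by move=> i; rewrite coefC; case: ifP => // _; exact: subring_set0.
suff hM : is_subfield M.
  apply: (@adjoin_min _ K [set a] M hM KM) => _ ->.
  exists 'X; last by rewrite hornerX.
  by move=> i; rewrite coefX; case: eqP => _; [case: hR|exact: subring_set0].
apply: subring_subfield; last by move=> b /F0K/KM.
have hP := subring_set_coef hR; split; first by apply: KM; case: hR.
- move=> _ _ [q Kq ->] [r Kr ->]; exists (q - r); last by rewrite !hornerE.
  exact: (subring_setB hP).
- move=> _ _ [q Kq ->] [r Kr ->]; exists (q * r); last by rewrite hornerM.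
  exact: (subring_setM hP).
Qed.

End AlgebraicClosure.

(** * Automorphisms and Kummer theory *)

Definition fixes (T : Type) (s : T -> T) (A : set T) : Prop :=
  forall x, A x -> s x = x.

Definition stabilizes (T : Type) (s : T -> T) (A : set T) : Prop :=
  forall x, A x -> A (s x).

Section Restriction.
Variable Om : fieldType.
Implicit Types (L M : set Om) (s t : Om -> Om).

Lemma restrictionT L s x : L x -> restriction L s x = s x.
Proof. by move=> Lx; rewrite /restriction patchT // in_setE. Qed.

Lemma restrictionN L s x : ~ L x -> restriction L s x = x.
Proof. by move=> Lx; rewrite /restriction patchC // in_setE. Qed.

Lemma restriction_comp L s t : stabilizes t L ->
  restriction L s \o restriction L t = restriction L (s \o t).
Proof.
move=> tL; apply/funext => x /=; have [Lx|nLx] := pselect (L x).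
  by rewrite !(restrictionT _ Lx) restrictionT //; exact: tL.
by rewrite !(restrictionN _ nLx).
Qed.

Lemma restriction_restriction L M s : L `<=` M ->
  restriction L (restriction M s) = restriction L s.
Proof.
move=> LM; apply/funext => x; have [Lx|nLx] := pselect (L x).
  by rewrite !restrictionT //; exact: LM.
by rewrite !restrictionN.
Qed.

Lemma stable_iter (T : Type) (A : set T) (s : T -> T) n :
  stabilizes s A -> stabilizes (iter n s) A.
Proof. by move=> sA x Ax; elim: n => //= n; exact: sA. Qed.

Lemma fixes_iter (T : Type) (A : set T) (s : T -> T) n :
  fixes s A -> fixes (iter n s) A.
Proof. by move=> sA x Ax; elim: n => //= n ->; exact: sA. Qed.

Lemma restriction_iter L s n : stabilizes s L ->
  iter n (restriction L s) = restriction L (iter n s).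
Proof.
move=> sL; elim: n => [|n IH].
  by apply/funext => x; rewrite /restriction /patch; case: ifP.
rewrite [LHS](_ : _ = restriction L s \o iter n (restriction L s)) // IH.
by rewrite restriction_comp //; exact: stable_iter.
Qed.

Lemma restriction_id L : restriction L id = id.
Proof. by apply/funext => x; rewrite /restriction /patch; case: ifP. Qed.

Lemma rmorph_iter (s : {rmorphism Om -> Om}) n :
  exists t : {rmorphism Om -> Om}, t =1 iter n s.
Proof.
elim: n => [|n [t tE]]; first by exists (idfun : {rmorphism Om -> Om}).
by exists (s \o t : {rmorphism Om -> Om}) => x /=; rewrite tE.
Qed.

End Restriction.

Section Automorphisms.
Variables (F : fieldType) (Om : closedFieldType) (iota : {rmorphism F -> Om}).
Hypothesis Om_alg : forall x : Om, algebraicOver iota x.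
Notation F0 := (range iota : set Om).
Implicit Types (K L M : set Om) (s t : {rmorphism Om -> Om}).

Lemma roots_finite (q : {poly Om}) : q != 0 ->
  exists r : seq Om, forall x, root q x = (x \in r).
Proof.
move=> q0; have [r rE] := closed_field_poly_normal q; exists r => x.
by rewrite rE rootZ ?lead_coef_eq0 // root_prod_XsubC.
Qed.

(** [Y] consists of the roots in [L] of polynomials over [F] killing the members of [A], so one
    finite set serves all automorphisms at once. *)
Lemma finite_stable L (A : seq Om) : [set` A] `<=` L ->
  exists Y : seq Om, [/\ uniq Y, {subset A <= Y}, [set` Y] `<=` L &
    forall s, fixes s F0 -> stabilizes s L -> {in Y, forall y, s y \in Y}].
Proof.
elim: A => [|x A IH] AL; first by exists [::].
have [y /= yA|Y [_ AY YL YS]] := IH; first by apply: AL; rewrite /= inE yA orbT.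
have Lx : L x by apply: AL; rewrite /= mem_head.
have [q q0 qx] := Om_alg x.
have [|r rP] := @roots_finite (map_poly iota q); first by rewrite map_poly_eq0.
exists (undup ([seq y <- r | y \in L] ++ Y)); split; first exact: undup_uniq.
- move=> y; rewrite inE mem_undup mem_cat mem_filter => /orP[/eqP ->|/AY ->].
    by rewrite -rP qx mem_set.
  by rewrite orbT.
- move=> y /=; rewrite mem_undup mem_cat mem_filter => /orP[/andP[]|/YL//].
  by rewrite in_setE.
- move=> s sF sL y; rewrite !mem_undup !mem_cat !mem_filter.
  move=> /orP[/andP[/set_mem Ly yr]|yY]; last by rewrite (YS s sF sL) ?orbT.
  rewrite mem_set /=; last exact: sL.
  rewrite -rP -[map_poly iota q](_ : map_poly s (map_poly iota q) = _).
    by rewrite fmorph_root rP yr.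
  by rewrite -map_poly_comp; apply: eq_map_poly => a /=; apply: sF; exists a.
Qed.

Lemma map_stable s (Y : seq Om) : uniq Y -> {in Y, forall y, s y \in Y} ->
  map s Y =i Y.
Proof.
move=> uY sY; have [|||_] := @uniq_min_size _ (map s Y) Y; last by [].
- by rewrite map_inj_uniq //; exact: fmorph_inj.
- by move=> _ /mapP[y yY ->]; exact: sY.
- by rewrite size_map.
Qed.

(** [s] is only an endomorphism, but it is injective and maps a finite set of conjugates of [x] into
    itself, hence onto itself. *)
Lemma aut_surj s L x : fixes s F0 -> stabilizes s L -> L x ->
  exists2 y, L y & s y = x.
Proof.
move=> sF sL Lx; have [|Y [uY xY YL /(_ s sF sL) sY]] := @finite_stable L [:: x].
  by move=> y /=; rewrite inE => /eqP ->.
have : x \in map s Y by rewrite map_stable // xY // mem_head.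
by case/mapP => y /YL Ly ->; exists y.
Qed.

Lemma restriction_Gal K L s : is_subfield L -> F0 `<=` K -> fixes s K ->
  stabilizes s L -> Gal K L (restriction L s).
Proof.
move=> hL F0K sK sL; have sF : fixes s F0 by move=> a /F0K/sK.
have hR := subfield_ring hL.
split.
- split.
  + by move=> x Lx; rewrite restrictionT //; exact: sL.
  + move=> x y /set_mem Lx /set_mem Ly; rewrite !restrictionT //.
    exact: fmorph_inj.
  + move=> x Lx; have [y Ly <-] := aut_surj sF sL Lx.
    by exists y => //; rewrite restrictionT.
- move=> x y /set_mem Lx /set_mem Ly.
  by rewrite !restrictionT ?rmorphD //; exact: subring_setD.
- move=> x y /set_mem Lx /set_mem Ly.
  by rewrite !restrictionT ?rmorphM //; exact: subring_setM.
- move=> x /set_mem Kx; rewrite /restriction /patch.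
  by case: ifP => // _; exact: sK.
- by move=> x /set_mem nLx; rewrite restrictionN.
Qed.

(** Trades a Galois element, which is the identity off [L] and hence no ring morphism of [Om], for a
    morphism [t] that computes everywhere. *)
Lemma Gal_extend K L (s : Om -> Om) : is_subfield L -> F0 `<=` K -> K `<=` L ->
  Gal K L s -> exists t, [/\ fixes t K, stabilizes t L & s = restriction L t].
Proof.
move=> hL F0K KL [[sL _ _] sD sM sK sN].
have {}sK : fixes s K by move=> a Ka; apply: sK; rewrite in_setE.
have [|a /F0K /sK //|t tE] := extend_embedding Om_alg hL _ sD sM.
  by move=> a /F0K/KL.
exists t; split.
- by move=> a Ka; rewrite tE ?sK //; exact: KL.
- by move=> x Lx; rewrite tE //; exact: sL.
- apply/funext => x; have [Lx|nLx] := pselect (L x); first by rewrite restrictionT ?tE.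
  by rewrite restrictionN // sN // in_setE.
Qed.

Lemma adjoin_stable s K A : stabilizes s K -> (forall x, A x -> adjoin K A (s x)) ->
  stabilizes s (adjoin K A).
Proof.
move=> sK sA; apply: (@adjoin_min _ K A (s @^-1` adjoin K A)) => //.
  by apply: preimage_subfield; exact: adjoin_subfield.
by move=> x /sK; exact: adjoin_base.
Qed.

Lemma adjoin_eq s t K A : (forall x, K x -> s x = t x) ->
  (forall x, A x -> s x = t x) -> forall x, adjoin K A x -> s x = t x.
Proof. by move=> stK stA; apply: adjoin_min => //; exact: eqset_subfield. Qed.

End Automorphisms.

(** * Kummer theory of exponent [p] *)

Section Kummer.
Variables (F : fieldType) (Om : closedFieldType) (iota : {rmorphism F -> Om}).
Hypothesis Om_alg : forall x : Om, algebraicOver iota x.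
Notation F0 := (range iota : set Om).
Variables (p : nat) (z : Om).
Hypothesis p_prime : prime p.
Hypothesis z_prim : p.-primitive_root z.
Hypothesis F0z : F0 z.
Implicit Types (K L M : set Om) (s t : {rmorphism Om -> Om}).

Let p_gt0 : (0 < p)%N. Proof. exact: prime_gt0. Qed.
Let pE : p%:R != 0 :> Om. Proof. exact: prim_root_natf_neq0 z_prim. Qed.
Let z0 : z != 0.
Proof.
apply/eqP => z0; have /eqP := prim_expr_order z_prim.
by rewrite z0 expr0n gtn_eqF // eq_sym oner_eq0.
Qed.

Lemma sum_expr_prim_root i :
  \sum_(j < p) (z ^+ i) ^+ j = if (p %| i)%N then p%:R else 0.
Proof.
case: ifP => [pi|/negP npi].
  rewrite (eq_bigr (fun=> 1)) ?sumr_const ?card_ord // => j _.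
  by move: pi; rewrite (prim_order_dvd z_prim) => /eqP ->; rewrite expr1n.
have zi1 : z ^+ i - 1 != 0.
  by rewrite subr_eq0; apply/negP; rewrite -(prim_order_dvd z_prim).
apply: (mulfI zi1); rewrite mulr0 -subrX1 -exprM mulnC exprM.
by rewrite (prim_expr_order z_prim) expr1n subrr.
Qed.

Lemma pth_root_conj s x : s (x ^+ p) = x ^+ p -> exists i : nat, s x = z ^+ i * x.
Proof.
have [->|x0] := eqVneq x 0; first by exists 0%N; rewrite rmorph0 mulr0.
rewrite rmorphXn => sx.
have : (s x / x) ^+ p = 1 by rewrite expr_div_n sx mulfV // expf_neq0.
by move=> /(prim_rootP z_prim)[i sxE]; exists i; rewrite -sxE divfK.
Qed.

Lemma iter_pth_root s x i n : fixes s F0 -> s x = z ^+ i * x ->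
  iter n s x = z ^+ (i * n) * x.
Proof.
move=> sF sx; elim: n => [|n IH]; first by rewrite muln0 mul1r.
rewrite iterS IH rmorphM rmorphXn sF // sx mulrA -exprD mulnS addnC.
by rewrite mulrC.
Qed.

Lemma iter_p_pth_root s x : fixes s F0 -> s (x ^+ p) = x ^+ p -> iter p s x = x.
Proof.
move=> sF /pth_root_conj[i /(iter_pth_root p sF) ->].
by rewrite mulnC exprM (prim_expr_order z_prim) expr1n mul1r.
Qed.

Lemma subfield_natr K n : is_subfield K -> K n%:R.
Proof.
move=> /subfield_ring hR; elim: n => [|n IH]; first exact: subring_set0.
by rewrite mulrS; apply: subring_setD => //; case: hR.
Qed.

(** Summation over the roots of unity kills the powers of [a] whose exponent is not a multiple of
    [p]; what survives is a polynomial in [a ^+ p]. *)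
Lemma trace_adjoin1 K a (q : {poly Om}) : is_subfield K -> F0 `<=` K ->
  K (a ^+ p) -> (forall i, K q`_i) -> K (\sum_(j < p) q.[z ^+ j * a]).
Proof.
move=> hK F0K Kap Kq; have hR := subfield_ring hK.
under eq_bigr do rewrite horner_coef.
rewrite exchange_big /=; apply: subring_set_sum => // i _.
under eq_bigr => j _ do rewrite exprMn -exprM mulnC exprM [_ * a ^+ i]mulrC mulrA.
rewrite -mulr_sumr sum_expr_prim_root; case: ifP => [/dvdnP[k ->]|_]; last first.
  by rewrite mulr0; exact: subring_set0.
apply: subring_setM => //; last exact: subfield_natr.
by apply: subring_setM => //; rewrite mulnC exprM; exact: subring_setX.
Qed.

Lemma map_poly_fixes s K (q : {poly Om}) : fixes s K -> (forall i, K q`_i) ->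
  map_poly s q = q.
Proof. by move=> sK Kq; apply/polyP => i; rewrite coef_map /= sK. Qed.

(** If [x = q.[a]] is fixed by [s], then it equals every [q.[z ^+ j * a]], so [p%:R * x] is the sum
    of [trace_adjoin1]; and [p] is invertible because [Om] has a primitive [p]-th root of unity. *)
Lemma fixed_adjoin1 s K a x : is_subfield K -> F0 `<=` K -> fixes s K ->
  s a = z * a -> K (a ^+ p) -> adjoin K [set a] x -> s x = x -> K x.
Proof.
move=> hK F0K sK sa Kap /(adjoin1_poly Om_alg hK F0K)[q Kq ->] sx.
have := trace_adjoin1 hK F0K Kap Kq.
rewrite (eq_bigr (fun=> q.[a])) => [|j _].
  rewrite sumr_const card_ord -mulr_natr => /subfield_div/(_ (subfield_natr p hK)).
  by rewrite mulfK //; apply.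
elim: {j}(val j) => [|j IH]; first by rewrite mul1r.
rewrite -{}IH in sx *.
have -> : z ^+ j.+1 * a = s (z ^+ j * a).
  rewrite rmorphM rmorphXn sa sK; last exact: F0K.
  by rewrite exprSr mulrA.
by rewrite -{1}(map_poly_fixes sK Kq) horner_map.
Qed.

Lemma Xn_sub_pth_power a : a != 0 ->
  'X^p - (a ^+ p)%:P = \prod_(i <- index_iota 0 p) ('X - (z ^+ i * a)%:P).
Proof.
move=> a0; rewrite -(big_map (fun i => z ^+ i * a) xpredT (fun c => 'X - c%:P)).
have lc : lead_coef ('X^p - (a ^+ p)%:P) = 1 by rewrite lead_coefXnsubC.
rewrite [LHS](@all_roots_prod_XsubC _ _ (map (fun i => z ^+ i * a) (index_iota 0 p))).
- by rewrite lc scale1r.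
- by rewrite size_XnsubC // size_map size_iota subn0.
- apply/allP => _ /mapP[i _ ->]; rewrite rootE !hornerE.
  by rewrite exprMn -exprM mulnC exprM (prim_expr_order z_prim) expr1n mul1r subrr.
- rewrite uniq_rootsE map_inj_in_uniq ?iota_uniq // => i j.
  rewrite !mem_index_iota => /andP[_ ip] /andP[_ jp] /(mulIf a0) /eqP.
  by rewrite (eq_prim_root_expr z_prim) !modn_small // => /eqP.
Qed.

Lemma subfield_coprime_power K a k : is_subfield K -> K (a ^+ p) -> K (a ^+ k) ->
  (0 < k < p)%N -> K a.
Proof.
move=> hK Kp Kk /andP[k0 kp]; have hR := subfield_ring hK.
have [->|a0] := eqVneq a 0; first exact: subring_set0.
case: (egcdnP p k0) => u v E _.
have cop : gcdn k p = 1%N.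
  by apply/eqP; rewrite -/(coprime k p) coprime_sym prime_coprime // gtnNdvd.
have -> : a = (a ^+ k) ^+ u / (a ^+ p) ^+ v.
  rewrite -!exprM mulnC E cop addn1 exprS mulnC mulfK //.
  by rewrite expf_neq0.
by apply: subfield_div => //; exact: subring_setX.
Qed.

(** This is the irreducibility of ['X^p - c] in disguise. The gcd of [q] and ['X^p - c] splits into
    some of the factors ['X - z ^+ i * a]. If it had [k < p] of them, its constant term would be
    [a ^+ k] up to a unit of [K], which with [a ^+ p] would put [a] in [K]. So it has all of them,
    including the one for [z * a]. *)
Lemma kummer_conjugate (Kt : fieldType) (v : {rmorphism Kt -> Om}) a c
    (q : {poly Kt}) : range v z -> ~ range v a -> v c = a ^+ p ->
  root (map_poly v q) a -> root (map_poly v q) (z * a).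
Proof.
set K := range v; move=> Kz nKa cE qa.
have hK : is_subfield K by exact: range_subfield.
have hR := subfield_ring hK.
have a0 : a != 0 by apply: contra_notN nKa => /eqP ->; exact: subring_set0.
pose g := gcdp q ('X^p - c%:P).
have gE : map_poly v g = gcdp (map_poly v q) ('X^p - (a ^+ p)%:P).
  by rewrite gcdp_map rmorphB /= map_polyXn map_polyC /= cE.
have XnE : 'X^p - c%:P != 0 by rewrite -size_poly_eq0 size_XnsubC.
have g0 : g != 0 by rewrite gcdp_eq0 negb_and XnE orbT.
pose h := (lead_coef g)^-1 *: g.
have hg : map_poly v h %= map_poly v g.
  by rewrite eqp_map eqp_scale // invr_eq0 lead_coef_eq0.
have hmonic : map_poly v h \is monic.
  by rewrite map_monic monicE lead_coefZ mulVf // lead_coef_eq0.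
have hq : map_poly v h %| map_poly v q by rewrite (eqp_dvdl _ hg) gE dvdp_gcdl.
have hX : map_poly v h %| 'X^p - (a ^+ p)%:P.
  by rewrite (eqp_dvdl _ hg) gE dvdp_gcdr.
have ha : root (map_poly v h) a.
  by rewrite (eqp_root hg) gE root_gcd qa rootE !hornerE subrr eqxx.
suff : root (map_poly v h) (z * a) by apply: root_dvdp.
have := hX; rewrite (Xn_sub_pth_power a0) => /dvdp_prod_XsubC[m].
set r := mask m _ => hr.
have {}hr : map_poly v h = \prod_(i <- r) ('X - (z ^+ i * a)%:P).
  by apply/eqP; rewrite -eqp_monic //; exact: monic_prod_XsubC.
have szr : (size r <= p)%N.
  by have := size_subseq (mask_subseq m (index_iota 0 p)); rewrite size_iota subn0.
have r0 : (0 < size r)%N.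
  by rewrite lt0n size_eq0; apply: contraTneq ha => r0; rewrite hr r0 big_nil root1.
have [rp|rp] := eqVneq (size r) p; last first.
  have Kr : K ((map_poly v h).[0]).
    apply: subring_set_horner => //; last exact: subring_set0.
    by move=> i; rewrite coef_map; exists h`_i.
  have E : (map_poly v h).[0] = (\prod_(i <- r) - z ^+ i) * a ^+ size r.
    rewrite hr horner_prod; elim: (r) => [|i r' IH]; first by rewrite !big_nil mul1r.
    by rewrite !big_cons IH hornerXsubC sub0r -mulNr mulrACA -exprS.
  have Kw : K (\prod_(i <- r) - z ^+ i).
    apply: (big_ind K); [by case: hR|exact: subring_setM|move=> i _].
    by apply: subring_setN => //; apply: subring_setX.
  have w0 : \prod_(i <- r) - z ^+ i != 0.
    by rewrite prodf_seq_neq0; apply/allP => i _; rewrite oppr_eq0 expf_neq0.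
  exfalso; apply: nKa; apply: (@subfield_coprime_power _ a (size r) hK).
  + by exists c.
  + by have := subfield_div hK Kr Kw; rewrite E mulrAC mulfV // mul1r.
  + by rewrite r0 ltn_neqAle rp.
have : map_poly v h %= 'X^p - (a ^+ p)%:P.
  by rewrite -dvdp_size_eqp // hr size_prod_XsubC rp size_XnsubC.
move/eqp_root ->; rewrite rootE !hornerE exprMn (prim_expr_order z_prim).
by rewrite mul1r subrr.
Qed.

Lemma kummer_aut K a : is_subfield K -> F0 `<=` K -> K (a ^+ p) -> ~ K a ->
  exists s, fixes s K /\ s a = z * a.
Proof.
move=> hK F0K Kap nKa; apply: (extend_conjugate Om_alg) => // q Kq qa.
have vK (x : subfield_type hK) : K (val x) by exact: subfield_valP.
have [q' q'E] := subfield_poly_lift hK Kq.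
have [c cE] := subfield_lift hK Kap.
have [y yE] := subfield_lift hK (F0K _ F0z).
rewrite -q'E in qa *; apply: kummer_conjugate cE qa; first by exists y.
by case=> b _ ba; apply: nKa; rewrite -ba; exact: vK.
Qed.

(** The Lagrange resolvent: if [iter p s x = x], then [s] multiplies it by [z ^+ j], and the
    resolvents for all [j < p] add up to [p%:R * x]. *)
Definition resolvent s x (j : nat) : Om :=
  \sum_(i < p) z^-1 ^+ (j * i) * iter i s x.

Lemma sum_resolvent s x : \sum_(j < p) resolvent s x j = p%:R * x.
Proof.
rewrite exchange_big /= (bigD1 (Ordinal p_gt0)) //= [X in _ + X]big1 ?addr0.
  rewrite (eq_bigr (fun=> x)) => [|j _]; last by rewrite muln0 mul1r.
  by rewrite sumr_const card_ord mulr_natl.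
move=> i i0; rewrite -mulr_suml.
have lt_ip := ltn_ord i.
have E : z^-1 ^+ i = z ^+ (p - i).
  apply: (@mulIf _ (z ^+ i)); first by rewrite expf_neq0.
  by rewrite -exprMn mulVf // expr1n -exprD subnK ?(prim_expr_order z_prim) // ltnW.
rewrite (eq_bigr (fun j : 'I_p => (z ^+ (p - i)) ^+ j)) => [|j _]; last first.
  by rewrite mulnC exprM E.
rewrite sum_expr_prim_root gtnNdvd ?mul0r ?subn_gt0 //.
by rewrite ltn_subrL p_gt0 andbT lt0n.
Qed.

Lemma resolvent_eigen s x j : fixes s F0 -> iter p s x = x ->
  s (resolvent s x j) = z ^+ j * resolvent s x j.
Proof.
move=> sF spx; rewrite /resolvent rmorph_sum mulr_sumr /=.
(* Applying [s] shifts the index by one: the sum over [1..p] replaces the one over [0..p-1], and the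
   end terms [f p] and [f 0] agree. *)
pose f i := z ^+ j * (z^-1 ^+ (j * i) * iter i s x).
rewrite (eq_bigr (fun i : 'I_p => f i.+1)) => [|i _]; last first.
  rewrite rmorphM rmorphXn fmorphV (sF _ F0z) /f mulnS exprD /= !mulrA.
  by rewrite -exprMn mulfV // expr1n mul1r.
have f0p : f p = f 0%N.
  rewrite /f spx muln0 mulnC exprM exprVn (prim_expr_order z_prim) invr1.
  by rewrite expr1n.
apply: (addrI (f 0%N)); rewrite -[in RHS]f0p [RHS]addrC.
by rewrite -(big_ord_recr p f) big_ord_recl.
Qed.

Lemma resolvent_in s x j K : subring_set K -> F0 `<=` K -> stabilizes s K -> K x ->
  K (resolvent s x j).
Proof.
move=> hK F0K sK Kx; apply: subring_set_sum => // i _.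
apply: subring_setM => //; last exact: stable_iter.
apply: subring_setX => //; apply: F0K.
exact: (subfieldV (range_subfield iota) F0z).
Qed.

Lemma subfield_pmulr K x : is_subfield K -> K (p%:R * x) -> K x.
Proof.
move=> hK Kx; have := subfield_div hK Kx (subfield_natr p hK).
by rewrite mulrAC mulfV // mul1r.
Qed.

(** The [p]-th power of a resolvent is fixed by the generator, hence lies in [K], and [x] is the sum
    of its resolvents divided by [p]. *)
Lemma cyclic_pth_roots K L : F0 `<=` K -> cyclic_ext p K L ->
  L `<=` adjoin K [set x | K (x ^+ p)].
Proof.
move=> F0K [[hK hL KL _ LK] [s [_ sp _] GalE]] x Lx.
have hR := subfield_ring hL.
have Gs : Gal K L s by rewrite GalE; exists 1%N.
have [t [tK tL sE]] := Gal_extend Om_alg hL F0K KL Gs.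
have tF : fixes t F0 by move=> a /F0K/tK.
have tp y : L y -> iter p t y = y.
  move=> Ly; rewrite -[RHS]sp sE restriction_iter //.
  by rewrite restrictionT.
have yL j : L (resolvent t x j) by apply: resolvent_in => // a /F0K/KL.
have yp j : K (resolvent t x j ^+ p).
  apply: LK; first exact: subring_setX.
  rewrite GalE => _ [m _ <-]; rewrite sE restriction_iter //.
  rewrite restrictionT; last exact: subring_setX.
  elim: m => //= m ->; rewrite rmorphXn resolvent_eigen ?tp // exprMn.
  by rewrite -exprM mulnC exprM (prim_expr_order z_prim) expr1n mul1r.
apply: (subfield_pmulr (adjoin_subfield _ _)).
rewrite -(sum_resolvent t); apply: subring_set_sum => [|j _].
  exact: subfield_ring (adjoin_subfield _ _).
exact: adjoin_gen.
Qed.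

Lemma algebraic_subfield K L : F0 `<=` K -> algebraic_ext K L.
Proof.
move=> F0K x _; have [q q0 qx] := Om_alg x.
exists (map_poly iota q); rewrite map_poly_eq0; split => // i.
exact/F0K/F0_poly.
Qed.

Lemma stable_adjoin1 s K a : fixes s K -> adjoin K [set a] (s a) ->
  stabilizes s (adjoin K [set a]).
Proof.
move=> sK sa; apply: adjoin_stable; first by move=> x Kx; rewrite sK.
by move=> _ ->.
Qed.

Lemma cyclic_adjoin1 K a : is_subfield K -> F0 `<=` K -> K (a ^+ p) -> ~ K a ->
  cyclic_ext p K (adjoin K [set a]).
Proof.
move=> hK F0K Kap nKa; set L := adjoin K [set a].
have hL : is_subfield L by exact: adjoin_subfield.
have hR := subfield_ring hL.
have KL : K `<=` L by exact: adjoin_base.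
have La : L a by exact: adjoin_gen.
have a0 : a != 0.
  by apply: contra_notN nKa => /eqP ->; exact: (subring_set0 (subfield_ring hK)).
have [s [sK sa]] := kummer_aut hK F0K Kap nKa.
have sF : fixes s F0 by move=> b /F0K/sK.
have sL : stabilizes s L.
  apply: (stable_adjoin1 sK); rewrite sa; apply: (subring_setM hR) => //.
  exact: (KL _ (F0K _ F0z)).
have Gs : Gal K L (restriction L s) by exact: restriction_Gal.
have sm m : iter m s a = z ^+ m * a.
  by rewrite (@iter_pth_root s a 1%N) ?mul1n // expr1.
split.
  split=> //; first exact: algebraic_subfield.
  move=> x Lx xfix; apply: (fixed_adjoin1 hK F0K sK sa) => //.
  by have := xfix _ Gs; rewrite restrictionT.
have iterE m x : L x -> forall t, fixes t K -> t a = z ^+ m * a -> t x = iter m s x.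
  move=> Lx t tK ta; have [u uE] := rmorph_iter s m.
  rewrite -uE; apply: adjoin_eq Lx.
    by move=> y Ky; rewrite uE tK // (fixes_iter _ sK).
  by move=> _ ->; rewrite uE sm.
exists (restriction L s).
  split=> //.
    move=> x; rewrite restriction_iter //.
    have [Lx|nLx] := pselect (L x); last by rewrite restrictionN.
    rewrite restrictionT // -(iterE p x Lx (idfun : {rmorphism Om -> Om})) //=.
    by rewrite (prim_expr_order z_prim) mul1r.
  move=> m /andP[m0 mp] /(_ a); rewrite restriction_iter // restrictionT // sm.
  move/eqP; rewrite -subr_eq0 -{2}[a]mul1r -mulrBl mulf_eq0 (negPf a0) orbF subr_eq0.
  by rewrite -(prim_order_dvd z_prim) gtnNdvd.
apply/seteqP; split => [t Gt|_ [m _ <-]].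
  have [u [uK uL tE]] := Gal_extend Om_alg hL F0K KL Gt.
  have [i ui] : exists i, u a = z ^+ i * a by apply: pth_root_conj; exact: uK.
  exists i => //; rewrite restriction_iter // tE; apply/funext => x.
  have [Lx|nLx] := pselect (L x); last by rewrite !restrictionN.
  by rewrite !restrictionT // (iterE i x).
have [u uE] := rmorph_iter s m; rewrite restriction_iter //.
rewrite -(_ : u = iter m s :> (_ -> _)); last exact/funext.
apply: restriction_Gal => //; first by move=> x Kx; rewrite uE (fixes_iter _ sK).
by move=> x Lx; rewrite uE; exact: (stable_iter m sL).
Qed.

(** The explicit form of [ext2] (see [ext2E]), in which stability under automorphisms and
    monotonicity in [K] are immediate. *)
Definition pth_closure K : set Om := adjoin K [set x | K (x ^+ p)].

Lemma ext2E K : is_subfield K -> F0 `<=` K -> ext2 p K = pth_closure K.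
Proof.
move=> hK F0K; apply/seteqP; split; apply: adjoin_sub; try exact: adjoin_base.
  by move=> x [L /= hL Lx]; exact: cyclic_pth_roots hL _ Lx.
move=> x /= Kx; have [Kx'|nKx] := pselect (K x); first exact: adjoin_base.
apply: adjoin_gen; exists (adjoin K [set x]); last exact: adjoin_gen.
exact: cyclic_adjoin1.
Qed.

Lemma pth_closure_subfield K : is_subfield (pth_closure K).
Proof. exact: adjoin_subfield. Qed.

Lemma pth_closure_base K : K `<=` pth_closure K.
Proof. exact: adjoin_base. Qed.

Lemma pth_closure_root K x : K (x ^+ p) -> pth_closure K x.
Proof. by move=> Kx; exact: adjoin_gen. Qed.

Lemma pth_closure_sub K K' : K `<=` K' -> pth_closure K `<=` pth_closure K'.
Proof.
move=> KK'; apply: adjoin_sub => [x Kx|x /= Kx].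
  by apply: adjoin_base; exact: KK'.
by apply: adjoin_gen; exact: KK'.
Qed.

Lemma pth_closure_stable s K : stabilizes s K -> stabilizes s (pth_closure K).
Proof.
move=> sK; apply: adjoin_stable => // x /= Kx.
by apply: pth_closure_root; rewrite -rmorphXn; exact: sK.
Qed.

(** [x] involves finitely many [p]-th roots, and they are removed one at a time: if [a] is not in
    the field [K'] of the remaining ones, some morphism fixes [K'] and multiplies [a] by [z], and an
    element of [K'(a)] fixed by it is in [K']. *)
Lemma pth_closure_fixed K x : is_subfield K -> F0 `<=` K -> pth_closure K x ->
  (forall s, fixes s K -> s x = x) -> K x.
Proof.
move=> hK F0K /(adjoin_finite hK)[r].
elim: r x => [|a r IH] x rK rx xfix.
  by apply: adjoin_min rx => //.
have ra : K (a ^+ p) by apply: rK; rewrite /= mem_head.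
have {}rK : [set` r] `<=` [set x | K (x ^+ p)].
  by move=> y yr; apply: rK; rewrite /= inE yr orbT.
apply: IH => //; set K' := adjoin K [set` r].
have {}rx : adjoin K' [set a] x.
  rewrite -adjoinU; apply: adjoin_sub rx; first exact: adjoin_base.
  move=> y /=; rewrite inE => /orP[/eqP ->|yr]; apply: adjoin_gen; [by right|by left].
have hK' : is_subfield K' by exact: adjoin_subfield.
have KK' : K `<=` K' by exact: adjoin_base.
have F0K' : F0 `<=` K' by move=> y /F0K/KK'.
have [K'a|nK'a] := pselect (K' a).
  by apply: adjoin_min rx => // _ ->.
have K'ap : K' (a ^+ p) by exact: KK'.
have [s [sK' sa]] := kummer_aut hK' F0K' K'ap nK'a.
apply: (fixed_adjoin1 hK' F0K' sK' sa K'ap rx).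
by apply: xfix => y /KK'/sK'.
Qed.

End Kummer.

(** * The tower of Kummer extensions and its Frattini subgroup *)

Section Tower.
Variables (F : fieldType) (Om : closedFieldType) (iota : {rmorphism F -> Om}).
Hypothesis Om_alg : forall x : Om, algebraicOver iota x.
Notation F0 := (range iota : set Om).
Variables (p : nat) (z : Om).
Hypothesis p_prime : prime p.
Hypothesis z_prim : p.-primitive_root z.
Hypothesis F0z : F0 z.
Implicit Types (K L M : set Om) (s t : {rmorphism Om -> Om}).
Notation Aut := {rmorphism Om -> Om}.
Notation F2 := (pth_closure p F0).
Notation F22 := (pth_closure p F2).
Notation F3 := (ext3 p F0).

Let hF0 : is_subfield F0. Proof. exact: range_subfield. Qed.
Let F0F2 : F0 `<=` F2. Proof. exact: pth_closure_base. Qed.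
Let F2F22 : F2 `<=` F22. Proof. exact: pth_closure_base. Qed.

Lemma ext2_base : ext2 p F0 = F2.
Proof. exact: (ext2E Om_alg p_prime z_prim F0z). Qed.

Lemma ext2_ext2_base : ext2 p (ext2 p F0) = F22.
Proof.
rewrite ext2_base; apply: (ext2E Om_alg p_prime z_prim F0z) => //.
exact: pth_closure_subfield.
Qed.

Lemma F2_stable s : fixes s F0 -> stabilizes s F2.
Proof. by move=> sF; apply: pth_closure_stable => x Fx; rewrite sF. Qed.

Lemma F22_stable s : fixes s F0 -> stabilizes s F22.
Proof. by move=> sF; apply: pth_closure_stable; exact: F2_stable. Qed.

Lemma F22_fixed x : F22 x -> (forall s, fixes s F0 -> s x = x) -> F0 x.
Proof.
move=> xF22 xfix.
apply: (pth_closure_fixed Om_alg p_prime z_prim F0z) => //.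
apply: (pth_closure_fixed Om_alg p_prime z_prim F0z) => //.
  exact: pth_closure_subfield.
by move=> s sF2; apply: xfix => a /F0F2/sF2.
Qed.

(** Satisfied by both [F22] and [F3], so that the Frattini argument is made once for [V] and [W].
    The lower bound puts the [p]-th roots of elements of [F] in [L]; the upper bound gives the
    exponent [p * p] and the fixed field [F]. *)
Definition normal_tower L : Prop :=
  [/\ is_subfield L, F2 `<=` L, L `<=` F22 & forall s, fixes s F0 -> stabilizes s L].

Lemma galois_of_stable L : is_subfield L -> F0 `<=` L -> L `<=` F22 ->
  (forall s, fixes s F0 -> stabilizes s L) -> galois_ext F0 L.
Proof.
move=> hL F0L LF22 sL; split => //; first exact: (algebraic_subfield Om_alg).
move=> x Lx xfix; apply: F22_fixed; first exact: LF22.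
move=> s sF; have := xfix _ (restriction_Gal Om_alg hL (fun _ h => h) sF (sL _ sF)).
by rewrite restrictionT.
Qed.

(** The product of ['X - y] over a finite Galois-stable set of conjugates of [x] in [L] has its
    coefficients in [F]. Any [s] over [F] therefore permutes its roots, even before [s] is known to
    preserve [L]. *)
Lemma stable_of_galois L s : galois_ext F0 L -> fixes s F0 -> stabilizes s L.
Proof.
move=> [_ hL F0L _ LF] sF x Lx.
have [|Y [uY xY YL YS]] := @finite_stable _ _ _ Om_alg L [:: x].
  by move=> y /=; rewrite inE => /eqP ->.
pose f : {poly Om} := \prod_(y <- Y) ('X - y%:P).
have fL i : L f`_i.
  have hR := subfield_ring hL; move: i; rewrite /f big_seq.
  apply: (subring_set_prod (subring_set_coef hR)) => y /YL Ly.
  exact: subring_set_XsubC.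
have fF i : F0 f`_i.
  apply: LF => //.
  move=> t /(Gal_extend Om_alg hL (fun _ h => h) F0L)[u [uF uL ->]].
  rewrite restrictionT //.
  rewrite -coef_map; suff -> : map_poly u f = f by [].
  rewrite /f rmorph_prod /=.
  under eq_bigr do rewrite rmorphB /= map_polyX map_polyC /=.
  transitivity (\prod_(c <- map u Y) ('X - c%:P)); first by rewrite big_map.
  apply: perm_big.
  apply: uniq_perm => //; first by rewrite map_inj_uniq //; exact: fmorph_inj.
  by apply: map_stable => //; exact: YS.
have : root f x by rewrite root_prod_XsubC xY // mem_head.
rewrite -(fmorph_root s) (map_poly_fixes sF fF) root_prod_XsubC.
exact: YL.
Qed.

Lemma F22_tower : normal_tower F22.
Proof.
split => //; first exact: pth_closure_subfield.
by move=> s sF; exact: F22_stable.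
Qed.

Lemma F3_tower : normal_tower F3.
Proof.
rewrite /ext3 ext2_base; split.
- exact: adjoin_subfield.
- exact: adjoin_base.
- apply: adjoin_min => //; first exact: pth_closure_subfield.
  move=> x [L [/= hL _] Lx].
  exact: (cyclic_pth_roots Om_alg p_prime z_prim F0z F0F2 hL).
- move=> s sF; apply: adjoin_stable; first exact: F2_stable.
  move=> x [L [hL LF] Lx]; apply: adjoin_gen; exists L => //=.
  exact: (stable_of_galois LF sF).
Qed.

(** The criterion that places roots of [a] and [1 + a] in [F3]: the hypothesis on conjugates says
    that [F2(b)] is normal over [F]. *)
Lemma F3_root b : F2 (b ^+ p) ->
  (forall s, fixes s F0 -> adjoin F2 [set b] (s b)) -> F3 b.
Proof.
move=> F2b sb; rewrite /ext3 ext2_base.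
have [|nF2b] := pselect (F2 b); first exact: adjoin_base.
have hF2 : is_subfield F2 by exact: pth_closure_subfield.
apply: adjoin_gen; exists (adjoin F2 [set b]); last exact: adjoin_gen.
split; first exact: (cyclic_adjoin1 Om_alg p_prime z_prim F0z).
apply: galois_of_stable; first exact: adjoin_subfield.
- by move=> a /F0F2 ?; exact: adjoin_base.
- apply: adjoin_min => //; first exact: pth_closure_subfield.
  by move=> _ ->; exact: pth_closure_root.
- move=> s sF; apply: adjoin_stable; first exact: F2_stable.
  by move=> _ ->; exact: sb.
Qed.

Lemma iter_p_F2 s x : fixes s F0 -> F2 x -> iter p s x = x.
Proof.
move=> sF F2x; have [u uE] := rmorph_iter s p; rewrite -uE.
apply: (adjoin_eq (t := (idfun : {rmorphism Om -> Om}))) F2x => [y Fy|y /= Fy].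
  by rewrite uE /= (fixes_iter _ sF).
by rewrite uE (iter_p_pth_root z_prim F0z) // sF.
Qed.

(** The source of finiteness in the tower: it provides inverses in [Gal] as iterates, and makes the
    finite quotients [p]-groups. *)
Lemma iter_pp_F22 s x : fixes s F0 -> F22 x -> iter (p * p) s x = x.
Proof.
move=> sF F22x; have [u uE] := rmorph_iter s p.
have uF2 : fixes u F2 by move=> y F2y; rewrite uE iter_p_F2.
have uF0 : fixes u F0 by move=> y /F0F2/uF2.
rewrite iterM -(eq_iter uE); have [v vE] := rmorph_iter u p; rewrite -vE.
apply: (adjoin_eq (t := (idfun : {rmorphism Om -> Om}))) F22x => [y Fy|y /= Fy].
  by rewrite vE /= (fixes_iter _ uF2).
by rewrite vE (iter_p_pth_root z_prim F0z) // uF2.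
Qed.

Section Frattini.
Variable L : set Om.
Hypothesis Ltower : normal_tower L.

Let hL : is_subfield L. Proof. by case: Ltower. Qed.
Let F0L : F0 `<=` L. Proof. by case: Ltower => _ F2L _ _ a /F0F2/F2L. Qed.
Let LF22 : L `<=` F22. Proof. by case: Ltower. Qed.
Let Lstable s : fixes s F0 -> stabilizes s L. Proof. by case: Ltower => _ _ _; exact. Qed.

Lemma tower_GalP K (s : Om -> Om) : F0 `<=` K -> K `<=` L ->
  Gal K L s <-> exists2 t : Aut, fixes t K & s = restriction L t.
Proof.
move=> F0K KL; split.
  by move=> /(Gal_extend Om_alg hL F0K KL)[t [tK _ ->]]; exists t.
move=> [t tK ->]; apply: (restriction_Gal Om_alg) => //.
by apply: Lstable => a /F0K/tK.
Qed.

Lemma tower_Gal_subgroup K : F0 `<=` K -> K `<=` L ->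
  is_subgroup (Gal F0 L) (Gal K L).
Proof.
move=> F0K KL; have KP := tower_GalP _ F0K KL.
have comp (s t : Om -> Om) : Gal K L s -> Gal K L t -> Gal K L (s \o t).
  move=> /KP[s' s'K ->] /KP[t' t'K ->]; apply/KP.
  exists (s' \o t' : {rmorphism Om -> Om}).
    by move=> x Kx /=; rewrite t'K // s'K.
  by rewrite restriction_comp //; apply: Lstable => a /F0K/t'K.
have Gid : Gal K L id.
  apply/KP; exists (idfun : {rmorphism Om -> Om}) => //.
  by rewrite [RHS]restriction_id.
split=> //.
  move=> s /KP[t tK ->]; apply/tower_GalP => //.
  by exists t => // a /F0K/tK.
move=> s Gs; have spp : iter (p * p) s = id.
  have [t tK ->] := (KP s).1 Gs; have tF : fixes t F0 by move=> a /F0K/tK.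
  rewrite restriction_iter; last exact: Lstable.
  apply/funext => x; have [Lx|nLx] := pselect (L x); last by rewrite restrictionN.
  by rewrite restrictionT // iter_pp_F22 //; exact: LF22.
have pp0 : (0 < p * p)%N by rewrite muln_gt0 prime_gt0.
exists (iter (p * p).-1 s).
  elim: (p * p).-1 => // n; exact: comp.
split; apply/funext => x /=.
  by rewrite -iterS prednK // spp.
by rewrite -iterSr prednK // spp.
Qed.

Lemma Gal_adjoin (A : seq Om) (h : Om -> Om) : [set` A] `<=` L -> Gal F0 L h ->
  {in A, forall a, h a = a} -> Gal (adjoin F0 [set` A]) L h.
Proof.
move=> AL /(tower_GalP _ (fun _ h => h) F0L)[t tF hE] hA.
have AL' : adjoin F0 [set` A] `<=` L by exact: adjoin_min.
apply/(tower_GalP _ (@adjoin_base _ _ _) AL'); exists t => // x.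
apply: (adjoin_eq (s := t) (t := (idfun : Aut))) => // a /= aA.
by rewrite -[RHS](hA _ aA) hE restrictionT //; exact: AL.
Qed.

Lemma Gal_adjoin_open (A : seq Om) : [set` A] `<=` L ->
  open_subgroup F0 L (Gal (adjoin F0 [set` A]) L).
Proof.
move=> AL; split; last by exists A.
apply: tower_Gal_subgroup; first exact: adjoin_base.
exact: adjoin_min.
Qed.

(** * Finite quotients of the Galois group as permutation groups *)

Section Permutations.
Variable Y : seq Om.
Hypothesis YL : [set` Y] `<=` L.
Hypothesis Ystable : forall s, fixes s F0 -> {in Y, forall y, s y \in Y}.
Notation E := (adjoin F0 [set` Y]).

Definition induces s (g : {perm seq_sub Y}) : Prop :=
  forall y, val (g y) = s (val y).

Lemma induces_exists s : fixes s F0 -> exists g, induces s g.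
Proof.
move=> sF; pose f (y : seq_sub Y) := SeqSub (Ystable sF (valP y)).
have f_inj : injective f by move=> a b /(congr1 val) /= /fmorph_inj/val_inj.
by exists (perm f_inj) => y; rewrite permE.
Qed.

Lemma induces1 : induces idfun 1%g.
Proof. by move=> y; rewrite perm1. Qed.

(** A product of permutations applies its left factor first, hence the reversed order of
    composition. *)
Lemma inducesM s t g h : induces s g -> induces t h -> induces (t \o s) (g * h)%g.
Proof. by move=> sg th y; rewrite permM th sg. Qed.

Lemma induces_iter s t g n : induces s g -> t =1 iter n s -> induces t (g ^+ n)%g.
Proof.
move=> sg tE y; rewrite tE; elim: n {tE} y => [|n IH] y; first by rewrite perm1.
by rewrite expgSr permM sg IH.
Qed.

Lemma induces_eq s t g x : fixes s F0 -> fixes t F0 -> induces s g ->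
  induces t g -> E x -> s x = t x.
Proof.
move=> sF tF sg tg; apply: adjoin_eq => [a Fa|y /= yY]; first by rewrite sF ?tF.
by have := sg (SeqSub yY); rewrite tg.
Qed.

Lemma induces_inj s g h : induces s g -> induces s h -> g = h.
Proof. by move=> sg sh; apply/permP => y; apply: val_inj; rewrite sg sh. Qed.

(** The Galois group of [E] over [F], seen through its faithful action on the generators [Y]. *)
Definition perm_image : {set {perm seq_sub Y}} :=
  [set g | `[< exists2 s : Aut, fixes s F0 & induces s g >]].

Lemma perm_imageP g :
  reflect (exists2 s : Aut, fixes s F0 & induces s g) (g \in perm_image).
Proof. by rewrite inE; exact: asboolP. Qed.

Lemma perm_image_group_set : group_set perm_image.
Proof.
apply/group_setP; split.
  by apply/perm_imageP; exists (idfun : {rmorphism Om -> Om}) => //; exact: induces1.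
move=> g h /perm_imageP[s sF sg] /perm_imageP[t tF th]; apply/perm_imageP.
exists (t \o s : {rmorphism Om -> Om}); last exact: inducesM.
by move=> a Fa /=; rewrite sF ?tF.
Qed.
Canonical perm_image_group := Group perm_image_group_set.

Lemma perm_image_pgroup : (p.-group perm_image)%g.
Proof.
apply/pgroupP => q q_prime /(Cauchy q_prime)[g /perm_imageP[s sF sg] gq].
have : (g ^+ (p * p) = 1)%g.
  have [t tE] := rmorph_iter s (p * p).
  apply/permP => y; apply: val_inj; rewrite (induces_iter sg tE) perm1 tE.
  by apply: iter_pp_F22 => //; apply: LF22; apply: YL; exact: (valP y).
move/eqP; rewrite -order_dvdn gq Euclid_dvdM // orbb.
by rewrite dvdn_prime2 // inE.
Qed.

(* [x] is a coefficient of the product over [h] in [M] of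
   [T - \sum_j h(y_j) Z^j], which determines the root [\sum_j y_j Z^j] up to
   the action of [M]. *)
Lemma artin_separation (M : {group {perm seq_sub Y}}) s g :
  M \subset perm_image -> fixes s F0 -> induces s g -> g \notin M ->
  exists x, [/\ E x, s x <> x &
    forall t h, fixes t F0 -> induces t h -> h \in M -> t x = x].
Proof.
move=> sMG sF sg gM.
have hE : is_subfield E by exact: adjoin_subfield.
have [aut autP] : {aut : {perm seq_sub Y} -> Aut &
    forall h, h \in M -> fixes (aut h) F0 /\ induces (aut h) h}.
  apply: (@boolp.choice {perm seq_sub Y} Aut (fun h t =>
    h \in M -> fixes t F0 /\ induces t h)) => h.
  have [hM|_] := boolP (h \in M); last by exists idfun.
  by have /perm_imageP[t tF th] := fintype.subsetP sMG h hM; exists t.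
(* [c] plays the part of a primitive element: its coefficients are the members of [Y], so distinct
   permutations give distinct images of [c]. *)
pose c : {poly Om} := Poly Y.
pose C h := map_poly (aut h) c.
have cE i : E c`_i.
  rewrite coef_Poly; have [iY|iY] := ltnP i (size Y).
    by apply: adjoin_gen; rewrite /= mem_nth.
  by rewrite nth_default //; exact: (subring_set0 (subfield_ring hE)).
have CE t h : fixes t F0 -> induces t h -> h \in M -> map_poly t c = C h.
  move=> tF th hM; have [aF ah] := autP _ hM.
  by apply/polyP => i; rewrite !coef_map; apply: induces_eq ah _.
pose P : {poly {poly Om}} := \prod_(h in M) ('X - (C h)%:P).
have Estable t : fixes t F0 -> stabilizes t E.
  move=> tF; apply: adjoin_stable.
    by move=> a Fa; rewrite tF //; exact: adjoin_base.
  by move=> y /= yY; apply: adjoin_gen; exact: Ystable.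
have PE i j : E (P`_i)`_j.
  have hP := subring_set_coef (subfield_ring hE).
  move: i j; apply: (subring_set_prod (subring_set_coef hP)) => h hM.
  apply: (subring_set_XsubC hP) => k; rewrite coef_map; apply: Estable => //.
  by have [] := autP _ hM.
have Pmap t : map_poly (map_poly t) P = \prod_(h in M) ('X - (map_poly t (C h))%:P).
  rewrite /P rmorph_prod; apply: eq_bigr => h _.
  by rewrite rmorphB /= map_polyX map_polyC.
have Pfix t h : fixes t F0 -> induces t h -> h \in M -> map_poly (map_poly t) P = P.
  move=> tF th hM; rewrite Pmap [RHS](reindex_inj (mulIg h)) /=.
  apply: eq_big => [k|k kM]; first by rewrite groupMr.
  congr ('X - _%:P); have [aF ak] := autP _ kM.
  rewrite -(@CE (t \o aut k : Aut) (k * h)%g).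
  - by rewrite /C -map_poly_comp.
  - by move=> a Fa /=; rewrite aF ?tF.
  - exact: inducesM.
  - by rewrite groupM.
have [allfix|] := pselect (forall i j, s (P`_i)`_j = (P`_i)`_j); last first.
  move=> /existsNP[i /existsNP[j sx]]; exists (P`_i)`_j; split => //.
  move=> t h tF th hM; have := Pfix t h tF th hM.
  by move=> /polyP/(_ i); rewrite coef_map => /polyP/(_ j); rewrite coef_map.
exfalso; have sP : map_poly (map_poly s) P = P.
  by apply/polyP => i; apply/polyP => j; rewrite !coef_map /= allfix.
have : root P c.
  rewrite -[c](_ : C 1%g = c) /P.
    by rewrite rootE horner_prod (bigD1 1%g) //= hornerXsubC subrr mul0r.
  by rewrite -(CE idfun 1%g) ?map_poly_id //; exact: induces1.
(* If [s] fixes the coefficients of [P], the image of the root [c] under [s] is again a root, that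
   is, some [C h]; comparing coefficients gives [g = h], which lies in [M]. *)
move=> /(rmorph_root (map_poly s)); rewrite sP rootE horner_prod.
move=> /prodf_eq0[h hM]; rewrite hornerXsubC subr_eq0 => /eqP sC.
have [aF ah] := autP _ hM.
suff /(induces_inj sg) gh : induces s h by rewrite gh hM in gM.
move=> y; rewrite ah; have /(nthP 0)[i iY <-] := valP y.
by have /polyP/(_ i) := sC; rewrite !coef_map coef_Poly => ->.
Qed.

(** In a [p]-group [M] is normal of index [p]. An [x] fixed by [M] and moved by some [s] outside [M]
    has resolvents for [s], and one of them is moved by [s] since they sum to [p%:R * x]. It is the
    required [a]: its [p]-th power is fixed by [M] and by [s], hence by the whole group. *)
Lemma maximal_pth_root (M : {group {perm seq_sub Y}}) : maximal M perm_image ->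
  exists a, [/\ E a, F0 (a ^+ p), ~ F0 a &
    forall t h, fixes t F0 -> induces t h -> h \in M -> t a = a].
Proof.
move=> maxM; have [sMG [g gG gM]] := properP (maxgroupp maxM).
have pG := perm_image_pgroup.
have nMG := p_maximal_normal pG maxM.
have iM : #|perm_image : M|%g = p := p_maximal_index pG maxM.
have /perm_imageP[s sF sg] := gG.
have [x [Ex sx Mx]] := artin_separation sMG sF sg gM.
have hE : is_subfield E by exact: adjoin_subfield.
have hR := subfield_ring hE.
have sE : stabilizes s E.
  apply: adjoin_stable; first by move=> a Fa; rewrite sF //; exact: adjoin_base.
  by move=> y /= yY; apply: adjoin_gen; exact: Ystable.
have nMg : g \in ('N(M))%g by exact: (fintype.subsetP (normal_norm nMG)).
(* The quotient by [M] has order [p], so [g ^+ p] lies in [M], which fixes [x]. *)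
have spx : iter p s x = x.
  have [t tE] := rmorph_iter s p; rewrite -tE.
  apply: (Mx t (g ^+ p)%g); last 1 first.
  - apply: coset_idr; first exact: groupX.
    rewrite morphX //= -iM -card_quotient; last exact: normal_norm.
    by apply: expg_cardG; exact: mem_quotient.
  - by move=> a Fa; rewrite tE (fixes_iter _ sF).
  - exact: induces_iter sg tE.
pose y j := resolvent p z s x j.
have sy j : s (y j) = z ^+ j * y j by exact: (resolvent_eigen p_prime z_prim F0z).
have [j syj] : exists j, s (y j) <> y j.
  apply: contrapT => /forallNP nsy; apply: sx.
  have p0 : p%:R != 0 :> Om by exact: prim_root_natf_neq0 z_prim.
  apply: (mulfI p0); rewrite -(sum_resolvent p_prime z_prim s x).
  rewrite -[LHS](_ : s (p%:R * x) = _); last by rewrite rmorphM rmorph_nat.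
  rewrite -(sum_resolvent p_prime z_prim s x) rmorph_sum; apply: eq_bigr => j _.
  by have /contrapT := nsy j.
have Ey : E (y j) := resolvent_in p F0z j hR (@adjoin_base _ _ _) sE Ex.
(* Normality of [M] is used here: moving [t] past the [i]-th iterate of [s] turns it into a morphism
   that induces a conjugate of [h], still in [M], and so fixes [x]. *)
have My t h : fixes t F0 -> induces t h -> h \in M -> t (y j) = y j.
  move=> tF th hM; rewrite /y /resolvent rmorph_sum; apply: eq_bigr => i _.
  rewrite rmorphM rmorphXn fmorphV (tF _ F0z); congr (_ * _).
  have [u uE] := rmorph_iter s i; rewrite -uE /=.
  have uF : fixes u F0 by move=> a Fa; rewrite uE (fixes_iter _ sF).
  have ug := induces_iter sg uE.
  have kM : (h ^ (g ^+ i)^-1)%g \in M by rewrite memJ_norm // groupV groupX.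
  have /perm_imageP[v vF vk] := fintype.subsetP sMG _ kM.
  rewrite -[in RHS](Mx v _ vF vk kM).
  apply: (@induces_eq (t \o u : Aut) (u \o v : Aut) (g ^+ i * h)%g) => //.
  - by move=> a Fa /=; rewrite uF ?tF.
  - by move=> a Fa /=; rewrite vF ?uF.
  - exact: inducesM.
  - have -> : (g ^+ i * h = h ^ (g ^+ i)^-1 * g ^+ i)%g.
      by rewrite conjgE invgK !mulgA mulgKV.
    exact: inducesM.
exists (y j); split => //; last first.
  by move=> Fy; apply: syj; exact: sF.
have {}syp : s (y j ^+ p) = y j ^+ p.
  rewrite rmorphXn sy exprMn -exprM mulnC exprM (prim_expr_order z_prim).
  by rewrite expr1n mul1r.
have Eyp : E (y j ^+ p) := subring_setX hR p Ey.
(* The stabilizer of the [p]-th power of the resolvent contains [M] and also [g]; by maximality it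
   is the whole group. *)
pose S := [set h in perm_image | `[< forall t : Aut,
  fixes t F0 -> induces t h -> t (y j ^+ p) = y j ^+ p >]]%SET.
have SP h : reflect (h \in perm_image /\ forall t : Aut,
    fixes t F0 -> induces t h -> t (y j ^+ p) = y j ^+ p) (h \in S).
  by rewrite [h \in S]finset.in_set; apply: (iffP andP) => -[? /asboolP].
have Sgroup : group_set S.
  apply/group_setP; split.
    apply/SP; split=> [|t tF t1]; first exact: group1.
    by rewrite (induces_eq tF _ t1 induces1).
  move=> h k /SP[hG hS] /SP[kG kS]; apply/SP; split; first exact: groupM.
  have /perm_imageP[u uF uh] := hG; have /perm_imageP[v vF vk] := kG.
  move=> t tF thk; rewrite (@induces_eq t (v \o u : Aut) (h * k)%g) //=.
  - by rewrite hS ?kS.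
  - by move=> a Fa /=; rewrite uF ?vF.
  - exact: inducesM.
have /maximal_eqP[_ maxP] : maximal_eq M perm_image by rewrite /maximal_eq maxM orbT.
have [||SM|SG] := maxP (Group Sgroup).
- apply/fintype.subsetP => h hM; apply/SP; split; first exact: (fintype.subsetP sMG).
  by move=> t tF th; rewrite rmorphXn (My t h).
- by apply/fintype.subsetP => h /SP[].
- have : g \in Group Sgroup.
    by apply/SP; split=> // t tF tg; rewrite (@induces_eq t s g).
  by rewrite SM (negPf gM).
apply: F22_fixed; first by apply: LF22; apply: adjoin_min Eyp.
move=> t tF; have [h th] := induces_exists tF.
have /SP[_] : h \in Group Sgroup by rewrite SG; apply/perm_imageP; exists t.
exact.
Qed.

End Permutations.

(** Openness lets [H] be tested on a finite stable [Y] containing [A]: its image there is proper,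
    hence inside a maximal subgroup, to which [maximal_pth_root] applies. *)
Lemma open_subgroup_root H : open_subgroup F0 L H -> H <> Gal F0 L ->
  exists a, [/\ L a, F0 (a ^+ p), ~ F0 a & forall h, H h -> h a = a].
Proof.
move=> [[HG Hid HM HV] [A AL AH]] HneG.
have [Y [uY AY YL YS]] := finite_stable Om_alg AL.
have {}YS (s : Aut) : fixes s F0 -> {in Y, forall y, s y \in Y}.
  by move=> sF; apply: YS => //; exact: Lstable.
have GP := fun s : Om -> Om => tower_GalP s (fun _ h => h) F0L.
pose Hbar := [set g | `[< exists s : Aut,
  [/\ fixes s F0, H (restriction L s) & induces s g] >]]%SET : {set {perm seq_sub Y}}.
have HbarP g : reflect (exists s : Aut,
    [/\ fixes s F0, H (restriction L s) & induces s g]) (g \in Hbar).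
  by rewrite inE; exact: asboolP.
have Hbar_group : group_set Hbar.
  apply/group_setP; split.
    apply/HbarP; exists (idfun : Aut); split => //; last exact: induces1.
    by rewrite [restriction L _]restriction_id.
  move=> g h /HbarP[s [sF Hs sg]] /HbarP[t [tF Ht th]]; apply/HbarP.
  exists (t \o s : Aut); split; last exact: inducesM.
    by move=> a Fa /=; rewrite sF ?tF.
  by rewrite -restriction_comp; [exact: HM|exact: Lstable].
have sHG : Hbar \subset perm_image Y.
  apply/fintype.subsetP => g /HbarP[s [sF _ sg]]; apply/perm_imageP.
  by exists s.
have [HG'|[M maxM sHM]] := @maximal_exists _ (Group Hbar_group) (perm_image_group Y) sHG.
  case: HneG; apply/seteqP; split => // v Gv.
  have /GP[s sF vE] := Gv.
  have [g sg] := induces_exists YS sF.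
  have /HbarP[t [tF Ht tg]] : g \in Group Hbar_group.
    by rewrite HG'; apply/perm_imageP; exists s.
  have [t' Ht' [tt' t't]] := HV _ Ht.
  (* [v] agrees on [A] with an element of [H]; the quotient of the two fixes [A], and so lies in [H]
     by openness. *)
  have -> : v = restriction L t \o (t' \o v).
    by rewrite compA tt'.
  apply: HM => //; apply: AH.
  have [_ _ Gcomp _] := tower_Gal_subgroup (fun _ h => h) F0L.
  apply: Gal_adjoin => //; first by apply: Gcomp => //; exact: HG.
  move=> a aA /=; have La : L a by exact: AL.
  have va : v a = restriction L t a.
    by rewrite vE !restrictionT //; have := sg (SeqSub (AY _ aA)); rewrite tg.
  by rewrite va; exact: (congr1 (@^~ a) t't).
have [a [Ea Fa nFa Ma]] := maximal_pth_root YL YS maxM.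
exists a; split => //; first by apply: adjoin_min Ea.
move=> h Hh; have /GP[s sF hE] := HG _ Hh; have [g sg] := induces_exists YS sF.
rewrite hE restrictionT; last by apply: adjoin_min Ea.
apply: (Ma s g) => //; apply: (fintype.subsetP sHM); apply/HbarP.
by exists s; rewrite -hE.
Qed.

(** A maximal open [H] fixes a [p]-th root [a] outside [F], hence equals the stabilizer of [a] by
    maximality. An [s] fixing all [p]-th roots of elements of [F] thus lies in every such [H]. *)
Lemma not_Frattini_moves (s : Om -> Om) : Gal F0 L s -> ~ Frattini_Gal F0 L s ->
  exists a, F0 (a ^+ p) /\ s a <> a.
Proof.
move=> Gs nPhi; apply: contrapT => /forallNP sfix; apply: nPhi.
have {}sfix a : F0 (a ^+ p) -> s a = a.
  by move=> Fa; apply: contrapT => sa; exact: (sfix a).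
split=> // H [Hopen HneG Hmax].
have [a [La Fa nFa Ha]] := open_subgroup_root Hopen HneG.
pose K := adjoin F0 [set` [:: a]].
have aL : [set` [:: a]] `<=` L by move=> x /=; rewrite inE => /eqP ->.
have GK h : Gal F0 L h -> h a = a -> Gal K L h.
  by move=> Gh ha; apply: Gal_adjoin => // x; rewrite inE => /eqP ->.
have Kopen : open_subgroup F0 L (Gal K L) by exact: Gal_adjoin_open.
have HK : H `<=` Gal K L.
  by move=> h Hh; apply: GK; [have [[+ _ _ _] _] := Hopen; apply|exact: Ha].
case: (Hmax _ Kopen HK) => [<-|KG]; first by apply: GK => //; exact: sfix.
exfalso; apply: nFa.
have [_ _ _ _ gal] := galois_of_stable hL F0L LF22 Lstable.
apply: gal => // h; rewrite -KG => -[_ _ _ hK _]; apply: hK.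
by rewrite in_setE; apply: adjoin_gen; rewrite /= mem_head.
Qed.

End Frattini.
End Tower.

(** * Torsion elements and orderings *)

Lemma has_order_exists (T : Type) (s : T -> T) n : (0 < n)%N -> iter n s =1 id ->
  exists2 m, has_order s m & (m <= n)%N.
Proof.
move=> n0 sn; pose P m := (0 < m)%N && `[< iter m s =1 id >].
have exP : exists m, P m by exists n; rewrite /P n0; exact/asboolP.
case: (ex_minnP exP) => m /andP[m0 /asboolP sm] mmin; exists m; last first.
  by apply: mmin; rewrite /P n0; exact/asboolP.
split=> // k /andP[k0 km] sk; have := mmin k; rewrite /P k0 leqNgt km.
by move=> /(_ _)/negP; apply => //; exact/asboolP.
Qed.

Lemma positive_cone_formally_real (F : fieldType) (P : set F) :
  positive_cone P -> formally_real F.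
Proof.
move=> [PD PM P0 PN] r.
have Psq x : x != 0 -> P (x ^+ 2).
  by move=> /PN[Px|Px]; [exact: PM|rewrite -sqrrN; exact: PM].
have P1 : P 1 by rewrite -(expr1n _ 2); apply: Psq; exact: oner_neq0.
have Psum : \sum_(x <- r) x ^+ 2 = 0 \/ P (\sum_(x <- r) x ^+ 2).
  elim: r => [|x r IH]; first by left; rewrite big_nil.
  rewrite big_cons; have [->|/Psq Px] := eqVneq x 0; first by rewrite expr0n add0r.
  by right; case: IH => [->|Pr]; [rewrite addr0|exact: PD].
apply/eqP => sumE; apply: P0; rewrite -(subrr 1).
apply: PD => //; rewrite -sumE; case: Psum => // sum0.
by move: sumE; rewrite sum0 => /esym/eqP; rewrite oppr_eq0 oner_eq0.
Qed.

Lemma pth_root_exists (Om : closedFieldType) n (x : Om) : (0 < n)%N ->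
  exists y, y ^+ n = x.
Proof.
move=> n0; have /closed_rootP[y] : size ('X^n - x%:P) != 1%N.
  by rewrite size_XnsubC // eqSS -lt0n.
by rewrite rootE !hornerE subr_eq0 => /eqP yx; exists y.
Qed.

Section Torsion.
Variables (F : fieldType) (Om : closedFieldType) (iota : {rmorphism F -> Om}).
Notation F0 := (range iota : set Om).
Notation Aut := {rmorphism Om -> Om}.
Variables (p : nat) (z : Om).
Hypothesis p_prime : prime p.
Hypothesis z_prim : p.-primitive_root z.
Hypothesis F0z : F0 z.

(** Tests the iterate only on elements available under each of (1), (2) and (3). Roots of [a]
    exclude odd [p] and yield [t i = - i]; roots of [1 + a] yield closure of the cone under
    addition. *)
Definition kummer_torsion (t : Om -> Om) : Prop :=
  forall a b, F0 (a ^+ p) -> t a <> a ->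
    (b ^+ p = a \/ p = 2%N /\ b ^+ 2 = 1 + a) -> iter p t b = b.

Variable t : Aut.
Hypothesis tF : fixes t F0.
Hypothesis t_torsion : kummer_torsion t.
Variable a : Om.
Hypothesis Fa : F0 (a ^+ p).
Hypothesis ta : t a <> a.

(* If [t] multiplies [a] by [w] then it multiplies a [p]-th root [b] of [a] by
   some [v] with [v ^+ p = w], and [t v = z ^+ k * v]; the condition
   [iter p t b = b] then reads [w * z ^+ (k * 'C(p, 2)) = 1]. *)
Lemma torsion_root : p = 2%N /\ forall y, y ^+ 2 = -1 -> t y = - y.
Proof.
have p0 := prime_gt0 p_prime.
have [b ba] := pth_root_exists a p0.
have [i tai] := pth_root_conj z_prim (tF Fa).
have a0 : a != 0 by apply/eqP => a0; apply: ta; rewrite a0 rmorph0.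
have b0 : b != 0 by apply: contra_neq a0 => b0; rewrite -ba b0 expr0n gtn_eqF.
pose v := t b / b.
have tb : t b = v * b by rewrite divfK.
have vp : v ^+ p = z ^+ i by rewrite expr_div_n -rmorphXn ba tai mulfK.
have v0 : v != 0 by rewrite mulf_neq0 ?invr_eq0 ?fmorph_eq0.
have [k tv] : exists k, t v = z ^+ k * v.
  by apply: (pth_root_conj z_prim); rewrite vp rmorphXn tF.
have iterb n : iter n t b = v ^+ n * z ^+ (k * 'C(n, 2)) * b.
  elim: n => [|n IH]; first by rewrite bin0n muln0 !mul1r.
  rewrite iterS IH !rmorphM !rmorphXn tv tb (tF F0z) exprMn -exprM.
  by rewrite binS bin1 mulnDr exprD exprSr; ring.
have := t_torsion Fa ta (or_introl ba); rewrite iterb => /eqP.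
rewrite -subr_eq0 -[X in _ - X]mul1r -mulrBl mulf_eq0 (negPf b0) orbF.
rewrite subr_eq0 vp => /eqP E.
have zi1 : z ^+ i != 1 by apply/eqP => zi; apply: ta; rewrite tai zi mul1r.
(* For odd [p] the binomial coefficient is divisible by [p], so the condition collapses to
   [z ^+ i = 1], against [t a <> a]. *)
have p2 : p = 2%N.
  have := prime_gt1 p_prime; rewrite leq_eqVlt => /orP[/eqP //|p_gt2].
  have /dvdnP[m mE] : (p %| 'C(p, 2))%N by rewrite prime_dvd_bin.
  move: E; rewrite mE mulnA mulnC exprM (prim_expr_order z_prim) expr1n mulr1.
  by move/eqP; rewrite (negPf zi1).
split=> //; have z2 := prim_expr_order z_prim; rewrite p2 in vp E z2.
have zN1 : z = -1.
  have /eqP := z2; rewrite sqrf_eq1 => /orP[/eqP z1|/eqP //].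
  by move: zi1; rewrite z1 expr1n eqxx.
(* For [p = 2] the ratio [v] is itself a square root of [-1], and the condition now reads
   [z ^+ k = -1], so [t] negates [v]. *)
have vN1 : v ^+ 2 = -1.
  have : (z ^+ i) ^+ 2 = 1 by rewrite -exprM mulnC exprM z2 expr1n.
  by rewrite vp => /eqP; rewrite sqrf_eq1 (negPf zi1) /= => /eqP.
have tvN : t v = - v.
  rewrite tv; have : z ^+ k = -1.
    by move: E; rewrite -vp vN1 muln1 mulN1r => /(canRL opprK).
  by move=> ->; rewrite mulN1r.
move=> y; rewrite -vN1 => /eqP; rewrite eqf_sqr => /orP[/eqP ->|/eqP ->] //.
by rewrite rmorphN tvN.
Qed.

Lemma torsion_positive_cone : positive_cone (fixed_sqrt_set iota t).
Proof.
have [p2 tI] := torsion_root.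
have [I I2] := pth_root_exists (-1 : Om) (isT : 0 < 2)%N.
have tIE := tI _ I2.
have two0 : 2%:R != 0 :> Om by rewrite -p2; exact: prim_root_natf_neq0 z_prim.
have fixP x y : x != 0 -> y ^+ 2 = iota x -> t y = y -> fixed_sqrt_set iota t x.
  move=> x0 yx ty; split=> // y'; rewrite -yx => /eqP.
  by rewrite eqf_sqr => /orP[/eqP ->|/eqP ->] //; rewrite rmorphN ty.
have sqrtP x : fixed_sqrt_set iota t x ->
    exists y, [/\ y ^+ 2 = iota x, t y = y & y != 0].
  move=> [x0 xP]; have [y yx] := pth_root_exists (iota x) (isT : 0 < 2)%N.
  exists y; rewrite xP //; split=> //; apply: contra_neq x0 => y0.
  by apply/eqP; rewrite -(fmorph_eq0 iota) -yx y0 expr0n.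
have I0 : I != 0.
  by apply/eqP => I0; move/eqP: I2; rewrite I0 expr0n eq_sym oppr_eq0 oner_eq0.
split.
- move=> x y /sqrtP[x' [x2 tx x0]] /sqrtP[y' [y2 ty y0]].
  (* Factor the sum as [y * (1 + u ^+ 2)] on the level of squares; a [t]-fixed root of the second
     factor comes from [1 + I * u] times its conjugate [1 - I * u]. *)
  pose u := x' / y'; have tu : t u = u by rewrite fmorph_div tx ty.
  have u0 : u != 0 by rewrite mulf_neq0 ?invr_eq0.
  have F0u : F0 ((I * u) ^+ p).
    rewrite p2 exprMn I2 expr_div_n x2 y2.
    by exists (- (x / y)) => //; rewrite rmorphN fmorph_div mulN1r.
  have tIu : t (I * u) <> I * u.
    rewrite rmorphM tIE tu mulNr => /eqP; rewrite eq_sym -addr_eq0 -mulr2n -mulr_natl.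
    by rewrite mulf_eq0 (negPf two0) /= mulf_eq0 (negPf I0) (negPf u0).
  have [b b2] := pth_root_exists (1 + I * u) (isT : 0 < 2)%N.
  have := t_torsion F0u tIu (or_intror (conj p2 b2)); rewrite p2 /= => ttb.
  pose v := b * t b.
  have tv : t v = v by rewrite rmorphM ttb mulrC.
  have v2 : v ^+ 2 = 1 + u ^+ 2.
    rewrite exprMn -rmorphXn b2 rmorphD rmorph1 rmorphM tIE tu.
    have -> : 1 + u ^+ 2 = 1 - I ^+ 2 * u ^+ 2 by rewrite I2 mulN1r opprK.
    ring.
  apply: (@fixP _ (y' * v)); last by rewrite rmorphM ty tv.
    rewrite -(fmorph_eq0 iota) rmorphD -x2 -y2.
    (* If [x + y] vanished, [u] would be a square root of [-1], negated by [t], although [t] fixes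
       it. *)
    apply/eqP => xy0; have uN1 : u ^+ 2 = -1.
      have y20 : y' ^+ 2 != 0 by rewrite expf_neq0.
      apply: (mulIf y20); rewrite -exprMn divfK // mulN1r.
      by apply/eqP; rewrite -addr_eq0 xy0.
    have := tI _ uN1; rewrite tu => /eqP; rewrite -addr_eq0 -mulr2n -mulr_natl.
    by rewrite mulf_eq0 (negPf two0) (negPf u0).
  rewrite exprMn v2 mulrDr mulr1 -exprMn mulrC divfK // rmorphD x2 y2.
  exact: addrC.
- move=> x y /sqrtP[x' [x2 tx x0]] /sqrtP[y' [y2 ty y0]].
  apply: (@fixP _ (x' * y')).
  + by rewrite -(fmorph_eq0 iota) rmorphM -x2 -y2 -exprMn expf_neq0 // mulf_neq0.
  + by rewrite exprMn x2 y2 rmorphM.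
  + by rewrite rmorphM tx ty.
- by case; rewrite eqxx.
- move=> x x0; have [y yx] := pth_root_exists (iota x) (isT : 0 < 2)%N.
  have : (t y) ^+ 2 = y ^+ 2 by rewrite -rmorphXn yx tF //; exists x.
  move=> /eqP; rewrite eqf_sqr => /orP[/eqP ty|/eqP ty]; first by left; exact: fixP ty.
  (* [t] negates both [I] and [y], so it fixes [I * y], a square root of [- x]. *)
  right; apply: (@fixP _ (I * y)); first by rewrite oppr_eq0.
    by rewrite exprMn I2 yx rmorphN mulN1r.
  by rewrite rmorphM tIE ty mulrNN.
Qed.

End Torsion.

(** * The involution attached to a formally real field *)

Section RealInvolution.
Variables (F : fieldType) (Om : closedFieldType) (iota : {rmorphism F -> Om}).
Hypothesis Om_alg : forall x : Om, algebraicOver iota x.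
Notation F0 := (range iota : set Om).
Notation Aut := {rmorphism Om -> Om}.
Hypothesis two0 : 2%:R != 0 :> Om.

Definition sums_of_squares (R : set Om) : set Om :=
  [set x | exists2 r : seq Om, [set` r] `<=` R & x = \sum_(y <- r) y ^+ 2].

Lemma sums_of_squares_sq R x : R x -> sums_of_squares R (x ^+ 2).
Proof.
move=> Rx; exists [:: x]; last by rewrite big_seq1.
by move=> y /=; rewrite inE => /eqP ->.
Qed.

Lemma sums_of_squaresD R x y : sums_of_squares R x -> sums_of_squares R y ->
  sums_of_squares R (x + y).
Proof.
move=> [r rR ->] [r' r'R ->]; exists (r ++ r'); last by rewrite big_cat.
by move=> w /=; rewrite mem_cat => /orP[/rR|/r'R].
Qed.

Lemma sums_of_squaresM R x y : subring_set R -> sums_of_squares R x ->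
  sums_of_squares R y -> sums_of_squares R (x * y).
Proof.
move=> hR [r rR ->] [r' r'R ->]; exists [seq u * v | u <- r, v <- r'].
  move=> _ /allpairsP[[u v] /= [ur vr ->]].
  by apply: (subring_setM hR); [exact: rR|exact: r'R].
rewrite big_allpairs_dep mulr_suml; apply: eq_bigr => u _.
by rewrite mulr_sumr; apply: eq_bigr => v _; rewrite exprMn.
Qed.

Lemma sums_of_squares_sub R : subring_set R -> sums_of_squares R `<=` R.
Proof.
move=> hR _ [r rR ->]; rewrite big_seq; apply: (subring_set_sum hR) => y /rR Ry.
exact: subring_setX.
Qed.

(** Zorn is run on subrings, which [subring_subfield] makes fields. An expression of [-1] as a sum
    of squares has finitely many terms, so in a chain it already occurs in one member. *)
Lemma max_real_subfield : formally_real F ->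
  exists R : set Om, [/\ subring_set R, F0 `<=` R, ~ sums_of_squares R (-1) &
    forall R', subring_set R' -> ~ sums_of_squares R' (-1) -> R `<=` R' -> R' = R].
Proof.
move=> Freal.
pose P := [set R : set Om | subring_set R /\ ~ sums_of_squares R (-1)].
have [||R [[hR Rreal] F0R Rmax]] := @Zorn_above _ P F0.
- split; first exact: subfield_ring (range_subfield iota).
  move=> [r rF E]; have [r' rE] : exists r' : seq F, r = map iota r'.
    elim: r rF {E} => [|x r IH] rF; first by exists [::].
    have [y yr|r' ->] := IH; first by apply: rF; rewrite /= inE yr orbT.
    have [|x' _ <-] := rF x; first by rewrite /= mem_head.
    by exists (x' :: r').
  have /eqP := Freal r'; apply; apply: (fmorph_inj iota).
  rewrite rmorphN rmorph1 E rE big_map rmorph_sum.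
  by apply: eq_bigr => y _; rewrite rmorphXn.
- move=> C [A0 CA0] CP Ctot; split.
    by apply: chain_subring_set => //; [exists A0|move=> A /CP[]].
  move=> [r rC E]; suff [A CA rA] : exists2 A, C A & [set` r] `<=` A.
    by have [_] := CP _ CA; apply; exists r.
  elim: r rC {E} => [|x r IH] rC; first by exists A0.
  have [y yr|A CA rA] := IH; first by apply: rC; rewrite /= inE yr orbT.
  have [|B CB Bx] := rC x; first by rewrite /= mem_head.
  have [AB|BA] := Ctot _ _ CA CB; [exists B|exists A] => // y /=;
    by rewrite inE => /orP[/eqP -> //|/rA]; auto.
by exists R; split => // R' hR' R'real; apply: Rmax.
Qed.

Section MaxReal.
Variable R : set Om.
Hypothesis hR : subring_set R.
Hypothesis F0R : F0 `<=` R.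
Hypothesis Rreal : ~ sums_of_squares R (-1).
Hypothesis Rmax : forall R', subring_set R' -> ~ sums_of_squares R' (-1) ->
  R `<=` R' -> R' = R.

Let hRf : is_subfield R. Proof. exact: (subring_subfield Om_alg). Qed.
Let R0 : R 0. Proof. exact: subring_set0. Qed.
Let R1 : R 1. Proof. by case: hR. Qed.

Definition quadratic_ext (w : Om) : set Om :=
  [set x | exists a b, [/\ R a, R b & x = a + b * w]].

Lemma quadratic_ext_base w : R `<=` quadratic_ext w.
Proof. by move=> x Rx; exists x, 0; rewrite mul0r addr0. Qed.

Lemma quadratic_ext_gen w : quadratic_ext w w.
Proof. by exists 0, 1; rewrite mul1r add0r. Qed.

Lemma quadratic_ext_subring w : R (w ^+ 2) -> subring_set (quadratic_ext w).
Proof.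
move=> Rw; split; first exact: quadratic_ext_base.
- move=> _ _ [a [b [Ra Rb ->]]] [c [d [Rc Rd ->]]].
  by exists (a - c), (b - d); split; [exact: subring_setB|exact: subring_setB|ring].
- move=> _ _ [a [b [Ra Rb ->]]] [c [d [Rc Rd ->]]].
  exists (a * c + b * d * w ^+ 2), (a * d + b * c).
  split; last ring.
    by apply: (subring_setD hR); apply: (subring_setM hR) => //; exact: subring_setM.
  by apply: (subring_setD hR); exact: subring_setM.
Qed.

Lemma quadratic_ext_inj w a b : ~ R w -> R a -> R b -> a + b * w = 0 ->
  a = 0 /\ b = 0.
Proof.
move=> nRw Ra Rb /eqP; rewrite addr_eq0 => /eqP E.
have b0 : b = 0.
  apply: contrapT => /eqP b0; apply: nRw.
  have -> : w = - a / b by rewrite E opprK mulrAC mulfV // mul1r.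
  by apply: subfield_div => //; exact: subring_setN.
by split=> //; rewrite E b0 mul0r oppr0.
Qed.

(** By maximality [-1] is a sum of squares in [R(w)]; its [R]-component reads [-1 = A + B * w ^+ 2]
    with [A], [B] sums of squares. Here [B != 0] because [R] is real, and dividing by [B] amounts to
    multiplying by [B] and a square. *)
Lemma max_real_nonsquare w : R (w ^+ 2) -> ~ R w -> sums_of_squares R (- w ^+ 2).
Proof.
move=> Rw nRw; have hQ := quadratic_ext_subring Rw.
have [r rQ E] : sums_of_squares (quadratic_ext w) (-1).
  apply: contrapT => nQ; apply: nRw; rewrite -(Rmax hQ nQ (@quadratic_ext_base w)).
  exact: quadratic_ext_gen.
have {rQ E} [A [B [c [SA SB Rc AB]]]] : exists A B c, [/\ sums_of_squares R A,
    sums_of_squares R B, R c & -1 = A + B * w ^+ 2 + c * w].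
  rewrite {}E; elim: r rQ => [|x r IH] rQ.
    exists 0, 0, 0; rewrite big_nil !mul0r !addr0.
    have S0 : sums_of_squares R 0 by exists [::]; rewrite ?big_nil.
    by split.
  have [y yr|A [B [c [SA SB Rc E]]]] := IH; first by apply: rQ; rewrite /= inE yr orbT.
  have [|a [b [Ra Rb ->]]] := rQ x; first by rewrite /= mem_head.
  exists (a ^+ 2 + A), (b ^+ 2 + B), (a * b + a * b + c); split.
  - by apply: sums_of_squaresD => //; exact: sums_of_squares_sq.
  - by apply: sums_of_squaresD => //; exact: sums_of_squares_sq.
  - by do ?[apply: subring_setD => //]; exact: subring_setM.
  - by rewrite big_cons E; ring.
have RA := sums_of_squares_sub hR SA; have RB := sums_of_squares_sub hR SB.
have [||AB0 _] := @quadratic_ext_inj w (1 + A + B * w ^+ 2) c nRw _ Rc.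
- apply: subring_setD => //; first exact: subring_setD.
  exact: subring_setM.
- rewrite -addrA -addrA (addrA A) -AB; exact: subrr.
have B0 : B != 0.
  apply/eqP => B0; apply: Rreal; have -> : -1 = A; last by [].
  by apply/eqP; rewrite eq_sym -addr_eq0 addrC -AB0 B0 mul0r addr0.
have -> : - w ^+ 2 = (1 + A) * B * B^-1 ^+ 2.
  have -> : 1 + A = - (B * w ^+ 2) by apply/eqP; rewrite -addr_eq0 AB0.
  by field.
apply: (sums_of_squaresM hR); last by apply: sums_of_squares_sq; exact: subfieldV.
apply: (sums_of_squaresM hR) => //; apply: sums_of_squaresD => //.
by rewrite -(expr1n _ 2); exact: sums_of_squares_sq.
Qed.

(** Otherwise both [w ^+ 2] and [- w ^+ 2] would be sums of squares, and so would [-1], their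
    product up to a square. *)
Lemma max_real_sqrt w : sums_of_squares R (w ^+ 2) -> R w.
Proof.
move=> Sw; apply: contrapT => nRw; have Rw := sums_of_squares_sub hR Sw.
have w0 : w != 0 by apply: contra_notN nRw => /eqP ->.
apply: Rreal; have -> : -1 = - w ^+ 2 * w ^+ 2 * (w ^+ 2)^-1 ^+ 2 by field.
apply: (sums_of_squaresM hR); last by apply: sums_of_squares_sq; exact: subfieldV.
by apply: (sums_of_squaresM hR) => //; exact: max_real_nonsquare.
Qed.

Variable I : Om.
Hypothesis I2 : I ^+ 2 = -1.

Let nRI : ~ R I.
Proof. by move=> RI; apply: Rreal; rewrite -I2; exact: sums_of_squares_sq. Qed.

Let hC : subring_set (quadratic_ext I).
Proof. by apply: quadratic_ext_subring; rewrite I2; exact: subring_setN. Qed.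

Lemma max_real_sqrtN w : R (w ^+ 2) -> R w \/ R (I * w).
Proof.
move=> Rw; have [|nRw] := pselect (R w); [by left|right].
by apply: max_real_sqrt; rewrite exprMn I2 mulN1r; exact: max_real_nonsquare.
Qed.

(** The classical formula: with [n] a root of [a ^+ 2 + b ^+ 2], which lies in [R], and [u] a root
    of [(a + n) / 2], a square root of [a + b * I] is [u + b / (2 * u) * I]. *)
Lemma complex_sqrt y : quadratic_ext I (y ^+ 2) -> quadratic_ext I y.
Proof.
have hN := subring_setN hC.
suff ex c : quadratic_ext I c -> exists2 y', quadratic_ext I y' & y' ^+ 2 = c.
  move=> /ex[y' Cy' /eqP]; rewrite eqf_sqr => /orP[/eqP <- //|/eqP yE].
  by rewrite -(opprK y) -yE; exact: hN.
move=> [a [b [Ra Rb ->]]].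
have [b0|b0] := eqVneq b 0.
  have [w wa] := pth_root_exists a (isT : 0 < 2)%N.
  exists w; last by rewrite b0 mul0r addr0.
  have [|Rw|RIw] := @max_real_sqrtN w; first by rewrite wa.
    exact: quadratic_ext_base.
  exists 0, (- (I * w)); split => //; first exact: subring_setN.
  by rewrite add0r mulNr mulrC mulrA -expr2 I2 mulN1r opprK.
have four0 : 4%:R != 0 :> Om by rewrite (natrM _ 2 2) mulf_neq0.
have [n nE] := pth_root_exists (a ^+ 2 + b ^+ 2) (isT : 0 < 2)%N.
have Rn : R n.
  by apply: max_real_sqrt; rewrite nE; apply: sums_of_squaresD; exact: sums_of_squares_sq.
(* Both signs of the root are allowed: [(a + n) / 2] and [(a - n) / 2] have product [- b ^+ 2 / 4],
   so only one of them has its square root in [R]. *)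
have key m : m ^+ 2 = a ^+ 2 + b ^+ 2 -> forall u, R u -> u ^+ 2 = (a + m) / 2%:R ->
    exists2 y', quadratic_ext I y' & y' ^+ 2 = a + b * I.
  move=> mE u Ru uE.
  have u0 : u != 0.
    apply: contra_neq b0 => u0; move: uE; rewrite u0 expr0n /= => /esym/eqP.
    rewrite mulf_eq0 invr_eq0 (negPf two0) orbF addr_eq0 => /eqP aE.
    apply/eqP; rewrite -sqrf_eq0; move/eqP: mE.
    by rewrite aE sqrrN -subr_eq0 opprD addrA subrr sub0r oppr_eq0.
  exists (u + b / (2%:R * u) * I).
    exists u, (b / (2%:R * u)); split => //.
    apply: subfield_div => //; apply: subring_setM => //.
    by rewrite mulr2n; exact: subring_setD.
  rewrite sqrrD exprMn I2 mulrN1 expr_div_n exprMn uE.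
  have am0 : a + m != 0.
    by apply: contra_neq u0 => am; apply/eqP; rewrite -sqrf_eq0 uE am mul0r.
  have b2 : b ^+ 2 = (m - a) * (m + a) by rewrite -subr_sqr mE; ring.
  rewrite b2; field.
  by rewrite two0 am0 four0.
have [u uE] := pth_root_exists ((a + n) / 2%:R) (isT : 0 < 2)%N.
have R2 : R 2%:R by rewrite mulr2n; exact: subring_setD.
have [|Ru|RIu] := @max_real_sqrtN u.
- by rewrite uE; apply: subfield_div => //; exact: subring_setD.
- exact: (key n nE u).
have [u0|u0] := eqVneq u 0.
  by apply: (key n nE u) => //; rewrite u0.
(* When only [I * u] lies in [R], the element [b / (2 * (I * u))] of [R] has square
   [(a - n) / 2]. *)
apply: (key (- n)); first by rewrite sqrrN.
  have Rv : R (b / (2%:R * (I * u))).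
    apply: subfield_div => //; exact: subring_setM.
  exact: Rv.
have I0 : I != 0.
  by apply/eqP => I0; apply: nRI; rewrite I0.
have an0 : a + n != 0.
  apply: contra_neq u0 => an; apply/eqP; rewrite -sqrf_eq0 uE an.
  by rewrite mul0r.
have b2 : b ^+ 2 = (n - a) * (a + n) by rewrite [a + n]addrC -subr_sqr nE; ring.
rewrite expr_div_n !exprMn I2 uE b2; field.
by rewrite two0 an0 four0 oppr_eq0 oner_eq0.
Qed.

Lemma pth_closure_complex K : K `<=` quadratic_ext I ->
  pth_closure 2 K `<=` quadratic_ext I.
Proof.
move=> KC; apply: adjoin_min => //; last by move=> y /= /KC; exact: complex_sqrt.
by apply: (subring_subfield Om_alg) => // x /F0R; exact: quadratic_ext_base.
Qed.

(** Conjugation on [R(I)] is extended to all of [Om] by [extend_graph]; the extension is claimed to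
    be an involution on [R(I)] alone. *)
Lemma complex_conjugation : exists t : Aut, [/\ fixes t F0, t I = - I &
  forall x, quadratic_ext I x -> t (t x) = x].
Proof.
pose G := [set u : Om * Om |
  exists a b, [/\ R a, R b, u.1 = a + b * I & u.2 = a - b * I]].
have [|||t tG] := @extend_graph _ _ _ Om_alg G.
- split.
  + by exists 1, 0; split; rewrite //= mul0r ?addr0 ?subr0.
  + move=> [x1 x2] [y1 y2] [a [b [Ra Rb /= -> ->]]] [c [d [Rc Rd /= -> ->]]].
    exists (a - c), (b - d); split; rewrite /=; try exact: subring_setB; ring.
  + move=> [x1 x2] [y1 y2] [a [b [Ra Rb /= -> ->]]] [c [d [Rc Rd /= -> ->]]].
    exists (a * c - b * d), (a * d + b * c); split; rewrite /=.
    * by apply: (subring_setB hR); exact: subring_setM.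
    * by apply: (subring_setD hR); exact: subring_setM.
    * have -> : - (b * d) = b * d * I ^+ 2 by rewrite I2 mulrN1.
      ring.
    * have -> : - (b * d) = b * d * I ^+ 2 by rewrite I2 mulrN1.
      ring.
- move=> y [a [b [Ra Rb /= /esym E ->]]].
  by have [-> ->] := quadratic_ext_inj nRI Ra Rb E; rewrite mul0r subr0.
- by move=> a /F0R Ra; exists a, 0; split; rewrite //= mul0r ?addr0 ?subr0.
have tE a b : R a -> R b -> t (a + b * I) = a - b * I.
  by move=> Ra Rb; apply: tG; exists a, b.
exists t; split.
- by move=> a /F0R Ra; have := tE a 0 Ra R0; rewrite mul0r addr0 subr0.
- by have := tE 0 1 R0 R1; rewrite mul1r add0r sub0r.
- move=> _ [a [b [Ra Rb ->]]]; rewrite tE // -mulNr tE //; last exact: subring_setN.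
  by rewrite mulNr opprK.
Qed.

End MaxReal.

Lemma real_involution : formally_real F -> exists (t : Aut) (I : Om),
  [/\ fixes t F0, I ^+ 2 = -1, t I = - I &
      fixes (t \o t) (pth_closure 2 (pth_closure 2 F0))].
Proof.
move=> /max_real_subfield[R [hR F0R Rreal Rmax]].
have [I I2] := pth_root_exists (-1 : Om) (isT : 0 < 2)%N.
have [t [tF tI tt]] := complex_conjugation hR F0R Rreal I2.
exists t, I; split=> // x xF22; apply: tt.
apply: (pth_closure_complex hR F0R Rreal Rmax I2) xF22.
apply: (pth_closure_complex hR F0R Rreal Rmax I2).
by move=> a /F0R; exact: quadratic_ext_base.
Qed.

End RealInvolution.

(** * Each condition yields Kummer torsion, and real fields yield involutions *)

Section Conditions.
Variables (F : fieldType) (Om : closedFieldType) (iota : {rmorphism F -> Om}).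
Hypothesis Om_alg : forall x : Om, algebraicOver iota x.
Notation F0 := (range iota : set Om).
Notation Aut := {rmorphism Om -> Om}.
Variables (p : nat) (z : Om).
Hypothesis p_prime : prime p.
Hypothesis z_prim : p.-primitive_root z.
Hypothesis F0z : F0 z.
Notation F2 := (pth_closure p F0).
Notation F22 := (pth_closure p F2).
Notation F3 := (ext3 p F0).

Let hF0 : is_subfield F0. Proof. exact: range_subfield. Qed.
Let F0F2 : F0 `<=` F2. Proof. exact: pth_closure_base. Qed.
Let hF2 : is_subfield F2. Proof. exact: pth_closure_subfield. Qed.

Lemma torsion_conclusion L (t : Aut) : normal_tower iota p L -> fixes t F0 ->
  kummer_torsion iota p t -> ~ Frattini_Gal F0 L (restriction L t) ->
  p = 2%N /\ positive_cone (fixed_sqrt_set iota (restriction L t)).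
Proof.
move=> Lt tF tt nPhi; have [hL F2L _ tL] := Lt.
have F0L : F0 `<=` L by move=> x /F0F2/F2L.
have Gt : Gal F0 L (restriction L t).
  by apply: (restriction_Gal Om_alg) => //; exact: tL.
have [a [Fa sa]] := not_Frattini_moves Om_alg p_prime z_prim F0z Lt Gt nPhi.
have ta : t a <> a.
  by move: sa; rewrite restrictionT //; apply: F2L; exact: pth_closure_root.
have [p2 _] := torsion_root p_prime z_prim F0z tF tt Fa ta.
split=> //; have := torsion_positive_cone p_prime z_prim F0z tF tt Fa ta.
have sqrtL x y : y ^+ 2 = iota x -> L y.
  by move=> yx; apply: F2L; apply: pth_closure_root; rewrite p2 yx; exists x.
congr positive_cone; apply/seteqP; split=> x [x0 xP]; split=> // y yx;
  by have := xP y yx; rewrite restrictionT //; exact: sqrtL yx.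
Qed.

Lemma subring_set_root_power (K : set Om) a b : subring_set K -> K a ->
  (b ^+ p = a \/ p = 2%N /\ b ^+ 2 = 1 + a) -> K (b ^+ p).
Proof.
move=> hK Ka [-> //|[p2 b2]]; rewrite p2 b2.
by apply: (subring_setD hK) => //; case: hK.
Qed.

Lemma F22_torsion (t : Aut) : fixes (iter p t) F22 -> kummer_torsion iota p t.
Proof.
move=> tF22 a b Fa ta bE; apply: tF22; apply: pth_closure_root.
have F2a : F2 a by exact: pth_closure_root.
exact: (subring_set_root_power (subfield_ring hF2) F2a).
Qed.

(** The roots [b] must be shown to lie in [F3], that is, every conjugate of [b] must lie in
    [F2(b)]. *)
Lemma F3_torsion (t : Aut) : fixes (iter p t) F3 -> kummer_torsion iota p t.
Proof.
move=> tF3 a b Fa ta bE; apply: tF3; have hR := subfield_ring hF2.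
have F2a : F2 a by exact: pth_closure_root.
apply: (F3_root Om_alg p_prime z_prim F0z).
  exact: (subring_set_root_power hR F2a).
move=> s sF; set E := adjoin F2 [set b].
have hE : is_subfield E by exact: adjoin_subfield.
have hER := subfield_ring hE.
have Eb : E b by exact: adjoin_gen.
have F2E : F2 `<=` E by exact: adjoin_base.
have [b0|b0] := eqVneq b 0; first by rewrite b0 rmorph0; exact: subring_set0.
case: bE => [ba|[p2 b2]].
  have [i sa] := pth_root_conj z_prim (sF _ Fa).
  have a0 : a != 0 by rewrite -ba expf_neq0.
  have F2c : F2 (s b / b).
    apply: pth_closure_root; rewrite expr_div_n -rmorphXn ba sa mulfK //.
    by apply: (subring_setX (subfield_ring hF0)).
  rewrite -(divfK b0 (s b)); exact: (subring_setM hER (F2E _ F2c) Eb).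
have Fa2 : F0 (a ^+ 2) by rewrite -p2.
have : (s a) ^+ 2 = a ^+ 2 by rewrite -rmorphXn sF.
move=> /eqP; rewrite eqf_sqr => /orP[/eqP sa|/eqP sa].
  have : (s b) ^+ 2 = b ^+ 2 by rewrite -rmorphXn b2 rmorphD rmorph1 sa.
  move=> /eqP; rewrite eqf_sqr => /orP[/eqP -> //|/eqP ->].
  exact: (subring_setN hER Eb).
(* When [s] negates [a], the square of [s b * b] is [1 - a ^+ 2], an element of [F], so [s b] is the
   inverse of [b] up to a factor in [F2]. *)
have F2c : F2 (s b * b).
  apply: pth_closure_root; rewrite p2 exprMn -rmorphXn b2 rmorphD rmorph1 sa.
  have -> : (1 - a) * (1 + a) = 1 - a ^+ 2 by ring.
  by have hF := subfield_ring hF0; apply: subring_setB => //; case: hF.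
rewrite -(mulfK b0 (s b)); exact: (subfield_div hE (F2E _ F2c) Eb).
Qed.

(** Apply (3) to [E = F(a)]: the roots [b] of [a] and [1 + a] are roots of elements of [E], so they
    lie in [ext2 p E]. *)
Lemma cyclic_torsion (t : Aut) : fixes t F0 ->
  (forall E, cyclic_ext p F0 E -> exists2 n,
    has_order (restriction (ext2 p E) (restriction F22 t)) n & (n <= p)%N) ->
  kummer_torsion iota p t.
Proof.
move=> tF tE a b Fa ta bE; have p0 := prime_gt0 p_prime.
have nFa : ~ F0 a by move=> /tF.
pose E := adjoin F0 [set a].
have cE : cyclic_ext p F0 E by exact: (cyclic_adjoin1 Om_alg p_prime z_prim F0z).
have [[_ hE F0E _ _] _] := cE.
have hER := subfield_ring hE.
have Ea : E a by exact: adjoin_gen.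
have tstab : stabilizes t E by apply: (stable_of_galois Om_alg _ tF); case: cE.
have [n] := tE E cE; rewrite (ext2E Om_alg p_prime z_prim F0z) //.
have EF22 : pth_closure p E `<=` F22.
  apply: pth_closure_sub; apply: adjoin_min => // _ ->; exact: pth_closure_root.
rewrite restriction_restriction //.
move=> [n0 tn _] np.
have tnE x : pth_closure p E x -> iter n t x = x.
  move=> Ex; rewrite -[RHS]tn restriction_iter; last exact: pth_closure_stable.
  by rewrite restrictionT.
(* [t] moves [a] by a nontrivial [p]-th root of unity, so [p] divides the order [n], which is at
   most [p]. *)
have pn : n = p.
  apply/eqP; rewrite eqn_leq np /=; apply: dvdn_leq => //.
  have [i tai] := pth_root_conj z_prim (tF _ Fa).
  have a0 : a != 0 by apply/eqP => a0; apply: ta; rewrite a0 rmorph0.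
  have := tnE a (pth_closure_base Ea); rewrite (iter_pth_root F0z n tF tai) => /eqP.
  rewrite -subr_eq0 -[X in _ - X]mul1r -mulrBl mulf_eq0 (negPf a0) orbF subr_eq0.
  rewrite -(prim_order_dvd z_prim) Euclid_dvdM // => /orP[|//].
  rewrite (prim_order_dvd z_prim) => /eqP zi; case: ta.
  by rewrite tai zi mul1r.
rewrite -{1}pn; apply: tnE; apply: pth_closure_root.
exact: (subring_set_root_power hER Ea).
Qed.

Lemma restriction_order_cyclic (t : Aut) E : fixes t F0 ->
  fixes (iter p t) F22 -> cyclic_ext p F0 E -> exists2 n,
    has_order (restriction (ext2 p E) (restriction F22 t)) n & (n <= p)%N.
Proof.
move=> tF tp cE; have [[_ hE F0E _ _] _] := cE.
have tstab : stabilizes t E by apply: (stable_of_galois Om_alg _ tF); case: cE.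
rewrite (ext2E Om_alg p_prime z_prim F0z) //.
have EF22 : pth_closure p E `<=` F22.
  by apply: pth_closure_sub; exact: (cyclic_pth_roots Om_alg p_prime z_prim F0z).
rewrite restriction_restriction //.
apply: has_order_exists; first exact: prime_gt0.
move=> x; rewrite restriction_iter; last exact: pth_closure_stable.
have [Ex|nEx] := pselect (pth_closure p E x); last by rewrite restrictionN.
by rewrite restrictionT // tp //; exact: EF22.
Qed.

(** The involution negates [I], so it lies outside the stabilizer of [I], a subgroup of index two
    and hence one of the maximal open subgroups. *)
Lemma real_has_involution L : normal_tower iota p L -> p = 2%N ->
  formally_real F -> exists s, (Gal F0 L `\` Frattini_Gal F0 L) s /\ has_order s p.
Proof.
move=> Lt p2 Freal; have [hL F2L LF22 tL] := Lt.
have F0L : F0 `<=` L by move=> x /F0F2/F2L.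
have two0 : 2%:R != 0 :> Om by rewrite -p2; exact: prim_root_natf_neq0 z_prim.
have [t [I [tF I2 tI tt]]] := real_involution Om_alg two0 Freal.
have I0 : I != 0.
  by apply/eqP => I0; move/eqP: I2; rewrite I0 expr0n eq_sym oppr_eq0 oner_eq0.
have NI : - I <> I.
  move=> /eqP; rewrite eq_sym -addr_eq0 -mulr2n -mulr_natl.
  by rewrite mulf_eq0 (negPf two0) (negPf I0).
have LI : L I.
  apply: F2L; apply: pth_closure_root; rewrite p2 I2.
  by exists (-1) => //; rewrite rmorphN rmorph1.
have [_ _ Gcomp _] :=
  tower_Gal_subgroup Om_alg p_prime z_prim F0z Lt (fun _ h => h) F0L.
have Gt : Gal F0 L (restriction L t).
  by apply: (restriction_Gal Om_alg) => //; exact: tL.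
have GI h : Gal F0 L h -> h I = I \/ h I = - I.
  move=> /(Gal_extend Om_alg hL (fun _ h => h) F0L)[u [uF uL ->]].
  rewrite restrictionT //; have : (u I) ^+ 2 = I ^+ 2.
    by rewrite -rmorphXn I2 rmorphN rmorph1.
  by move=> /eqP; rewrite eqf_sqr => /orP[/eqP|/eqP]; [left|right].
exists (restriction L t); split; last first.
  rewrite p2; split=> //.
    move=> x; rewrite restriction_iter; last exact: tL.
    have [Lx|nLx] := pselect (L x); last by rewrite restrictionN.
    by rewrite restrictionT //; apply: tt; have := LF22 _ Lx; rewrite p2.
  by move=> [|[|m]] // _ /(_ I); rewrite /= restrictionT // tI.
split=> // -[_ Phi].
have IL : [set` [:: I]] `<=` L by move=> x /=; rewrite inE => /eqP ->.
pose H := Gal (adjoin F0 [set` [:: I]]) L.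
have HI h : H h -> h I = I.
  move=> [_ _ _ hK _]; apply: hK; rewrite in_setE; apply: adjoin_gen.
  by rewrite /= mem_head.
have GH h : Gal F0 L h -> h I = I -> H h.
  move=> Gh hI; apply: (Gal_adjoin Om_alg Lt) => // x.
  by rewrite inE => /eqP ->.
have : H (restriction L t).
  apply: Phi; split.
  - exact: (Gal_adjoin_open Om_alg p_prime z_prim F0z Lt).
  - by move=> HG; move: Gt; rewrite -HG => /HI; rewrite restrictionT // tI.
  (* If [H'] has an element [k] outside [H], then [k] negates [I], and any [v] negating [I] is [k]
     times an element fixing [I]. *)
  - move=> H' [[H'G _ H'M H'V] _] HH'.
    have [H'H|] := pselect (H' `<=` H); first by left; apply/seteqP.
    move=> /existsNP[k /not_implyP[H'k nHk]]; right; apply/seteqP; split => // v Gv.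
    have Gk := H'G _ H'k.
    have kI : k I = - I by have [kI|] := GI _ Gk => //; case: nHk; exact: GH.
    have [k' H'k' [kk' k'k]] := H'V _ H'k; have Gk' := H'G _ H'k'.
    have [vI|vI] := GI _ Gv; first by apply: HH'; exact: GH.
    have -> : v = k \o (k' \o v) by rewrite compA kk'.
    apply: H'M => //; apply: HH'; apply: GH; first exact: Gcomp.
    by rewrite /= vI -kI; exact: (congr1 (@^~ I) k'k).
by move=> /HI; rewrite restrictionT // tI.
Qed.

End Conditions.

(* Fbar, with the embedding iota, is an algebraic closure of F. *)
Theorem theoremA3 (p : nat) (F : fieldType) (Fbar : closedFieldType)
    (iota : {rmorphism F -> Fbar}) (xi : F)
    (p_prime : prime p)
    (xi_prim : p.-primitive_root xi)
    (Fbar_alg : forall x : Fbar, algebraicOver iota x) :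
  let F0 : set Fbar := range iota in
  let V_F := V_ p F0 in
  let W_F := W_ p F0 in
  let cond1 (s : Fbar -> Fbar) :=
    (V_F `\` Phi_V p F0) s /\ has_order s p in
  let cond2 (s : Fbar -> Fbar) :=
    (W_F `\` Phi_W p F0) s /\ has_order s p in
  let cond3 (s : Fbar -> Fbar) :=
    (V_F `\` Phi_V p F0) s /\
    forall E : set Fbar, cyclic_ext p F0 E ->
      exists2 n : nat, has_order (restriction (ext2 p E) s) n & (n <= p)%N in
  let cond4 := p = 2%N /\ formally_real F in
  [/\ (exists s, cond1 s) <-> (exists s, cond2 s),
      (exists s, cond1 s) <-> (exists s, cond3 s),
      (exists s, cond1 s) <-> cond4 &
      cond4 -> forall s, cond1 s \/ cond2 s ->
        positive_cone (fixed_sqrt_set iota s)].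
Proof.
move=> F0 V_F W_F cond1 cond2 cond3 cond4.
pose z := iota xi.
have z_prim : p.-primitive_root z by rewrite fmorph_primitive_root.
have F0z : F0 z by exists xi.
pose F22 := pth_closure p (pth_closure p F0).
have F22E : ext2 p (ext2 p F0) = F22.
  exact: (ext2_ext2_base Fbar_alg p_prime z_prim F0z).
have F22t : normal_tower iota p F22 by exact: F22_tower.
have F3t : normal_tower iota p (ext3 p F0).
  exact: (F3_tower Fbar_alg p_prime z_prim F0z).
have VE : V_F = Gal F0 F22 by rewrite /V_F /V_ F22E.
have PhiE : Phi_V p F0 = Frattini_Gal F0 F22 by rewrite /Phi_V F22E.
have ext L s : normal_tower iota p L -> Gal F0 L s -> exists t : {rmorphism Fbar -> Fbar},
    [/\ fixes t F0, s = restriction L t & iter p s =1 id -> fixes (iter p t) L].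
  move=> Lt Gs; have [hL F2L _ tL] := Lt.
  have F0L : F0 `<=` L by move=> x Fx; apply: F2L; exact: pth_closure_base.
  have [t [tF tLs sE]] := Gal_extend Fbar_alg hL (fun _ h => h) F0L Gs.
  exists t; split=> // sp x Lx; rewrite -[RHS]sp sE restriction_iter //.
  by rewrite restrictionT.
(* Each condition on [s] gives [p = 2] and the cone at once; a cone makes [F] formally real, so the
   equivalences close up through [cond4]. *)
have c1 s : cond1 s -> p = 2%N /\ positive_cone (fixed_sqrt_set iota s).
  rewrite /cond1 VE PhiE => -[[Gs nPhi] [_ sp _]].
  have [t [tF sE /(_ sp) tp]] := ext _ _ F22t Gs; rewrite sE in nPhi *.
  by apply: (torsion_conclusion Fbar_alg p_prime z_prim F0z) => //; exact: F22_torsion.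
have c2 s : cond2 s -> p = 2%N /\ positive_cone (fixed_sqrt_set iota s).
  move=> -[[Gs nPhi] [_ sp _]].
  have [t [tF sE /(_ sp) tp]] := ext _ _ F3t Gs; rewrite sE in nPhi *.
  apply: (torsion_conclusion Fbar_alg p_prime z_prim F0z) => //.
  exact: (F3_torsion Fbar_alg p_prime z_prim F0z).
have c3 s : cond3 s -> p = 2%N /\ positive_cone (fixed_sqrt_set iota s).
  rewrite /cond3 VE PhiE => -[[Gs nPhi] sE3].
  have [t [tF sE _]] := ext _ _ F22t Gs; rewrite sE in nPhi sE3 *.
  apply: (torsion_conclusion Fbar_alg p_prime z_prim F0z) => //.
  exact: (cyclic_torsion Fbar_alg p_prime z_prim F0z).
have c13 s : cond1 s -> cond3 s.
  rewrite /cond1 /cond3 VE => -[sV [_ sp _]]; split=> // E cE.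
  have [t [tF sE /(_ sp) tp]] := ext _ _ F22t sV.1.
  rewrite sE; exact: (restriction_order_cyclic Fbar_alg p_prime z_prim F0z).
have c4 s : p = 2%N /\ positive_cone (fixed_sqrt_set iota s) -> cond4.
  by move=> [p2 /positive_cone_formally_real].
have c41 : cond4 -> exists s, cond1 s.
  rewrite /cond1 VE PhiE => -[]; exact: (real_has_involution Fbar_alg p_prime z_prim F0z).
have c42 : cond4 -> exists s, cond2 s.
  by move=> []; exact: (real_has_involution Fbar_alg p_prime z_prim F0z).
split.
- by split=> [[s /c1/c4/c42]|[s /c2/c4/c41]].
- by split=> [[s /c13]|[s /c3/c4/c41]] //; exists s.
- by split=> [[s /c1/c4]|/c41].
- by move=> _ s [/c1[]|/c2[]].
Qed.
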